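(* Let $Y$ be a random variable with stable law $\phi_{c,\alpha,\beta}$ (where $c>0$, $\alpha\in(0,2]$, $\beta\in[-1,1]$), and for $n\ge1$ let $Y_n$ be a random variable with the following compound Poisson distribution: if $\mu_n$ is the law of $Y_n$, then its Fourier transform is $$\widehat{\mu_n}(\xi)=\int_{\mathbb R}e^{ix\xi}\,\mu_n(dx)=\exp\left(\int_{\mathbb R}(e^{ix\xi}-1)\,n\,\phi_{\frac{c}{n^{1/\alpha}},\alpha,\beta}(dx)\right).$$ Then the Kolmogorov distance between $Y_n$ and $Y$ satisfies $$d_{\mathrm{Kol}}(Y_n,Y)\le\begin{cases}C(\alpha)\,n^{-1/\alpha}&\text{if }\alpha\in(1,2],\\ C(\alpha)\,n^{-1}&\text{if }\alpha\in(0,1)\text{ or }\alpha=1,\ \beta=0,\\ C'\,(\log n)^2\,n^{-1}&\text{if }\alpha=1,\ \beta\ne0,\end{cases}$$ with constants $C(\alpha)$ or $C'$ that depend only on the exponent $\alpha$.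
   Context: $d_{\mathrm{Kol}}(X,Y)=\sup_{a\in\mathbb R}|\mathbb P[X\le a]-\mathbb P[Y\le a]|$ is the Kolmogorov distance. For $c>0$, $\alpha\in(0,2]$, $\beta\in[-1,1]$, the stable law $\phi_{c,\alpha,\beta}$ is the probability law on $\mathbb R$ with $\int e^{ix\xi}\phi_{c,\alpha,\beta}(dx)=e^{\eta_{c,\alpha,\beta}(i\xi)}$, where $\eta_{c,\alpha,\beta}(i\xi)=-|c\xi|^\alpha(1-i\beta\,h(\alpha,\xi)\,\mathrm{sgn}(\xi))$, $h(\alpha,\xi)=\tan(\frac{\pi\alpha}{2})$ if $\alpha\neq1$ and $h(1,\xi)=-\frac2\pi\log|\xi|$.
   Formalization: For α=1, β≠0 the claim fails at n=1 (log 1=0) and no C' is uniform in c; the bound C'(log n)²/n is instead proved with universal C' for n≥n₀(c), and for all n≥2 with a constant K(c) depending on c. *)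

(* Defs.v *)
From HB Require Import structures.
From mathcomp Require Import all_boot all_order all_algebra.
From mathcomp Require Import all_classical all_reals all_analysis.
From mathcomp Require Import complex.

Set Implicit Arguments.
Unset Strict Implicit.
Unset Printing Implicit Defensive.

Import Order.TTheory GRing.Theory Num.Theory.
Import numFieldNormedType.Exports.

Local Open Scope classical_set_scope.
Local Open Scope ring_scope.
Local Open Scope complex_scope.

Definition expC (R : realType) (z : R[i]) : R[i] :=
  (expR (complex.Re z) * cos (complex.Im z)) +i*
  (expR (complex.Re z) * sin (complex.Im z)).

(* [Rintegral] is meaningful only for integrable functions; below it is only
   used on bounded continuous integrands against probability measures. *)
Definition integralC (R : realType) (mu : probability R R)
    (f : R -> R[i]) : R[i] :=
  (\int[mu]_x complex.Re (f x)) +i* (\int[mu]_x complex.Im (f x)).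

Definition fourier (R : realType) (mu : probability R R) (xi : R) : R[i] :=
  integralC mu (fun x => expC ('i * (x * xi)%:C)).

Definition stable_h (R : realType) (alpha xi : R) : R :=
  if alpha == 1 then - (2 / pi) * ln `|xi| else tan (pi * alpha / 2).

(* The value at [i * xi] of the exponent of the stable law. It vanishes at
   [xi = 0] for every [alpha > 0], since [0 `^ alpha = 0]. *)
Definition stable_exponent (R : realType) (c alpha beta xi : R) : R[i] :=
  - (`|c * xi| `^ alpha)%:C *
    (1 - 'i * (beta * stable_h alpha xi * Num.sg xi)%:C).

(* A probability law on the real line is determined by its Fourier transform,
   so at most one [mu] satisfies this predicate. *)
Definition stable_law (R : realType) (c alpha beta : R)
    (mu : probability R R) : Prop :=
  forall xi : R, fourier mu xi = expC (stable_exponent c alpha beta xi).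

Definition compound_Poisson (R : realType) (lambda : R)
    (phi mu : probability R R) : Prop :=
  forall xi : R, fourier mu xi =
    expC (integralC phi
            (fun x => (expC ('i * (x * xi)%:C) - 1) * lambda%:C)).

Definition dKol (R : realType) (d d' : measure_display)
    (T : measurableType d) (T' : measurableType d')
    (P : probability T R) (P' : probability T' R)
    (X : {RV P >-> R}) (Y : {RV P' >-> R}) : \bar R :=
  ereal_sup [set `|cdf X a - cdf Y a|%E | a in [set: R]].

(* Main.v *)
Require Import Defs.
From HB Require Import structures.
From mathcomp Require Import all_boot all_order all_algebra.
From mathcomp Require Import all_classical all_reals all_analysis.
From mathcomp Require Import measurable_realfun complex ring lra.
Import Order.TTheory GRing.Theory Num.Theory.
Import numFieldNormedType.Exports.
Local Open Scope classical_set_scope.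
Local Open Scope ring_scope.

(** Esseen's smoothing inequality with the Fejer kernel [(1 - cos (T x)) / (T x^2)],
    whose Fourier transform is the triangle [1 - |t| / T]: if [Y] has bounded
    density, the Kolmogorov distance is at most a constant times
    [1 / T + \int_0^T |f_n - f| / t], where [f_n], [f] are the characteristic
    functions.  If [z] is the stable exponent and [v = |c t|^alpha], then
    [f = exp z] and [f_n = exp (n (exp (z / n) - 1))], so that
    [|f_n - f| <= 2 |z|^2 exp (- v / 2) / n] as long as [v <= n]. One therefore
    takes [T = n^(1 / alpha) / c]: the first term contributes [n^(- 1 / alpha)] and
    the second one [1 / n], with an extra factor [1 + (ln c)^2] when [z] contains
    a logarithm. *)

Set Implicit Arguments.
Unset Strict Implicit.
Unset Printing Implicit Defensive.

(** The difference [D] of two distribution functions is not known to be integrable, so no Fourier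
    transform of [D] is available to start from. Increments [D (b - x) - D (a - x)] are smoothed
    instead: the resulting kernel [(sin ((b - u) t) - sin ((a - u) t)) / t] is bounded by [b - a],
    which justifies every exchange of integrals near [t = 0]. The final bound does not involve [a]
    and [b], so [a] can be pushed left until both distribution functions are negligible there. The
    Fejer kernel is left unnormalised, for only a lower bound near [0] and a tail bound of order
    [1 / (T h)] are used. The tail error is proportional to the supremum of [|D|] itself, and it is
    absorbed by making its coefficient smaller than [1]. No density of [Y] is constructed. What
    replaces it is a bound on the mass of short intervals, obtained from the same kernel and the
    decay of the characteristic function. The constants are free of [c] because
    [T * c = n^(1 / alpha)]; only a logarithm can bring [c] back. *)

(** * Fubini and the fundamental theorem of calculus for real-valued integrals *)

Lemma bounded_integrable d (T : measurableType d) (R : realType)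
    (mu : {measure set T -> \bar R}) (A : set T) (f : T -> R) (L : R) :
  measurable A -> (mu A < +oo)%E -> measurable_fun A f ->
  (forall x, A x -> `|f x| <= L) -> mu.-integrable A (EFin \o f).
Proof.
move=> mA Aoo mf fL; apply: measurable_bounded_integrable => //.
exists L; split; first by rewrite num_real.
by move=> M LM x Ax; exact: le_trans (fL x Ax) (ltW LM).
Qed.

(** A bounded kernel on a rectangle of finite measure is integrable for the product measure;
    extending it by zero outside the rectangle reduces the exchange to [Fubini] on the whole
    space. *)
Lemma Rintegral_Fubini d1 d2 (T1 : measurableType d1) (T2 : measurableType d2)
    (R : realType) (m1 : {sigma_finite_measure set T1 -> \bar R})
    (m2 : {sigma_finite_measure set T2 -> \bar R}) (A : set T1) (B : set T2)
    (k : T1 * T2 -> R) (L : R) :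
  measurable A -> measurable B -> (m1 A < +oo)%E -> (m2 B < +oo)%E ->
  measurable_fun setT k -> (forall x y, A x -> B y -> `|k (x, y)| <= L) ->
  \int[m1]_(x in A) \int[m2]_(y in B) k (x, y) =
  \int[m2]_(y in B) \int[m1]_(x in A) k (x, y).
Proof.
move=> mA mB Aoo Boo mk kL.
have mAB : measurable (A `*` B) by exact: measurableX.
pose g : T1 * T2 -> \bar R := (EFin \o k) \_ (A `*` B).
have gi : (m1 \x m2)%E.-integrable setT g.
  apply/integrable_restrict => //; rewrite setTI.
  apply: (@bounded_integrable _ _ _ _ _ _ L) => //.
  - apply: (@le_lt_trans _ _ (m1 A * m2 B)%E); first by rewrite -product_measure1E.
    by rewrite lte_mul_pinfty// ge0_fin_numE.
  - exact: measurable_funTS.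
  - by move=> [x y] [/= Ax By]; exact: kL.
have ik1 x : A x -> m2.-integrable B (fun y => (k (x, y))%:E).
  move=> Ax; apply: (@bounded_integrable _ _ _ _ _ _ L) => //.
  - apply: measurable_funTS; exact: measurableT_comp mk _.
  - by move=> y By; exact: kL.
have ik2 y : B y -> m1.-integrable A (fun x => (k (x, y))%:E).
  move=> By; apply: (@bounded_integrable _ _ _ _ _ _ L) => //.
  - apply: measurable_funTS; exact: measurableT_comp mk _.
  - by move=> x Ax; exact: kL.
have := Fubini gi; rewrite /Rintegral => gE.
transitivity (fine (\int[m1]_x \int[m2]_y g (x, y))).
  rewrite integral_mkcond; congr fine; apply: eq_integral => x _.
  rewrite patchE; case: ifPn => xA.
    rewrite fineK; last by apply: integrable_fin_num => //; apply/ik1/set_mem.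
    rewrite integral_mkcond; apply: eq_integral => y _; rewrite /g !patchE.
    by rewrite in_setX xA.
  by rewrite integral0_eq// => y _; rewrite /g patchE in_setX (negbTE xA).
rewrite gE [in RHS]integral_mkcond; congr fine; apply: eq_integral => y _.
rewrite patchE; case: ifPn => yB.
  rewrite fineK; last by apply: integrable_fin_num => //; apply/ik2/set_mem.
  rewrite [RHS]integral_mkcond; apply: eq_integral => x _; rewrite /g !patchE.
  by rewrite in_setX yB andbT.
by rewrite integral0_eq// => x _; rewrite /g patchE in_setX (negbTE yB) andbF.
Qed.

Lemma Rintegral_derive (R : realType) (F f : R -> R) (a b : R) : a <= b ->
  (forall x, a <= x <= b -> is_derive x 1 F (f x)) ->
  (forall x, a <= x <= b -> derivable f x 1) ->
  \int[lebesgue_measure]_(x in `[a, b]) f x = F b - F a.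
Proof.
rewrite le_eqVlt => /predU1P[<-|ab] F'f f'.
  by rewrite set_itv1 Rintegral_set1 subrr.
have dF x : a <= x <= b -> derivable F x 1 by move=> /F'f[].
have /(continuous_within_itvP _ ab)[cF cFa cFb] : {within `[a, b], continuous F}.
  by apply: derivable_within_continuous => x; rewrite in_itv; exact: dF.
rewrite /Rintegral (continuous_FTC2 (F := F))// ?EFinB//.
- by apply: derivable_within_continuous => x; rewrite in_itv; exact: f'.
- split => // x; rewrite in_itv /= => /andP[ax xb].
  by apply: dF; rewrite !ltW.
- move=> x; rewrite in_itv /= => /andP[ax xb]; rewrite derive1E.
  by have [] := F'f x; rewrite ?ltW.
Qed.

Lemma derivable_integrable (R : realType) (f : R -> R) (a b : R) :
  (forall x, a <= x <= b -> derivable f x 1) ->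
  (@lebesgue_measure R).-integrable `[a, b] (EFin \o f).
Proof.
move=> f'; apply: continuous_compact_integrable; first exact: segment_compact.
by apply: derivable_within_continuous => x; rewrite in_itv; exact: f'.
Qed.

(** * First estimates on sine and cosine *)

Lemma derive_ge0_le (R : realType) (f df : R -> R) (u : R) : 0 <= u ->
  (forall t, 0 <= t <= u -> is_derive t 1 f (df t)) ->
  (forall t, 0 <= t <= u -> 0 <= df t) -> f 0 <= f u.
Proof.
move=> u0 f' df0; have [| |c + fE] := @MVT_segment _ f df 0 u u0.
- by move=> x; rewrite in_itv /= => /andP[? ?]; apply: f'; rewrite !ltW.
- by apply: derivable_within_continuous => x; rewrite in_itv /= => /f'[].
- rewrite in_itv /= => /df0 c0.
  by rewrite -subr_ge0 fE subr0 mulr_ge0.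
Qed.

Lemma sin_le_id (R : realType) (u : R) : 0 <= u -> sin u <= u.
Proof.
move=> u0; pose f (t : R) : R := t - sin t.
have f' (t : R) : is_derive t 1 f (1 - cos t) by apply: is_derive_eq.
have := derive_ge0_le u0 (fun t _ => f' t).
rewrite /f sin0 subrr subr_ge0; apply => t _.
by rewrite subr_ge0 cos_le1.
Qed.

Lemma cos_ge (R : realType) (u : R) : 1 - u ^+ 2 / 2 <= cos u.
Proof.
wlog u0 : u / 0 <= u => [H|].
  by rewrite -cos_norm -real_normK ?num_real// H.
pose f (t : R) : R := cos t + t ^+ 2 / 2.
have f' (t : R) : is_derive t 1 f (t - sin t).
  by apply: is_derive_eq; rewrite /GRing.scale /=; field.
have := derive_ge0_le u0 (fun t _ => f' t).
rewrite /f cos0 expr0n mul0r addr0 lerBlDr; apply => t /andP[t0 _].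
by rewrite subr_ge0 sin_le_id.
Qed.

Lemma measurable_fun_cos d (T : measurableType d) (R : realType) (D : set T)
  (f : T -> R) : measurable_fun D f -> measurable_fun D (fun x => cos (f x)).
Proof.
move=> mf; apply: (@measurableT_comp _ _ _ _ _ _ (@cos R)) => //.
by apply: continuous_measurable_fun; exact: continuous_cos.
Qed.

Lemma measurable_fun_sin d (T : measurableType d) (R : realType) (D : set T)
  (f : T -> R) : measurable_fun D f -> measurable_fun D (fun x => sin (f x)).
Proof.
move=> mf; apply: (@measurableT_comp _ _ _ _ _ _ (@sin R)) => //.
by apply: continuous_measurable_fun; exact: continuous_sin.
Qed.

(** * The Fejer kernel *)

(** The integral form, unlike the closed quotient, needs no convention at [x = 0] and can be
    exchanged directly with other integrals. *)
Definition fejer (R : realType) (T x : R) : R :=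
  \int[lebesgue_measure]_(t in `[0, T]) ((1 - t / T) * cos (x * t)).

Section fejer.
Context {R : realType}.
Variable T : R.
Hypothesis T0 : 0 < T.
Notation mu := (@lebesgue_measure R).

Lemma fejerE (x : R) : x != 0 -> fejer T x = (1 - cos (x * T)) / (T * x ^+ 2).
Proof.
move=> x0; have Tn0 : T != 0 by rewrite gt_eqF.
(* One integration by parts in [t], with [sin (x t) / x] as antiderivative of the cosine. *)
pose F (t : R) : R := (1 - t / T) * sin (x * t) / x - cos (x * t) / (T * x ^+ 2).
have dF (t : R) : is_derive t 1 F ((1 - t / T) * cos (x * t)).
  by apply: is_derive_eq; rewrite /GRing.scale /=; field; rewrite Tn0 x0.
rewrite /fejer (Rintegral_derive (ltW T0) (fun t _ => dF t))// /F.
by rewrite divff// subrr !mul0r mulr0 sin0 cos0 mulr0 mul0r; field; rewrite Tn0 x0.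
Qed.

Lemma fejer_integrable x : mu.-integrable `[0, T] (EFin \o (fun t => (1 - t / T) * cos (x * t))).
Proof. exact: derivable_integrable. Qed.

Lemma weight_ge0 t : 0 <= t <= T -> 0 <= 1 - t / T <= 1.
Proof.
move=> /andP[t0 tT]; rewrite subr_ge0 ler_pdivrMr// mul1r tT/=.
by rewrite gerBl divr_ge0// ltW.
Qed.

Lemma integral_weight : \int[mu]_(t in `[0, T]) (1 - t / T) = T / 2.
Proof.
have Tn0 : T != 0 by rewrite gt_eqF.
pose F (t : R) : R := t - t ^+ 2 / (2 * T).
have dF (t : R) : is_derive t 1 F (1 - t / T).
  by apply: is_derive_eq; rewrite /GRing.scale /=; field.
by rewrite (Rintegral_derive (ltW T0) (fun t _ => dF t))// /F; field.
Qed.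

(** On this range [|x t| <= 1], hence [cos (x t) >= 1 / 2], and the weight [1 - t / T] has integral
    [T / 2]. *)
Lemma fejer_ge x : `|x| <= T^-1 -> T / 4 <= fejer T x.
Proof.
move=> xT; rewrite (_ : T / 4 = \int[mu]_(t in `[0, T]) ((1 - t / T) * 2^-1)).
  apply: le_Rintegral => //; [exact: derivable_integrable|exact: fejer_integrable|].
  move=> t /=; rewrite in_itv /= => tT; have /andP[w0 _] := weight_ge0 tT.
  apply: ler_wpM2l => //; apply: le_trans (cos_ge _).
  have xt : `|x * t| <= 1.
    rewrite normrM (le_trans (ler_pM _ _ xT (_ : `|t| <= T)))// ?mulVf ?gt_eqF//.
    by case/andP: tT => t0 tT; rewrite ger0_norm.
  have : (x * t) ^+ 2 <= 1 by rewrite -real_normK ?num_real// exprn_ile1.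
  lra.
rewrite RintegralZr//; last exact: derivable_integrable.
by rewrite integral_weight; field.
Qed.

Lemma fejer_ge0 x : 0 <= fejer T x.
Proof.
have [->|x0] := eqVneq x 0.
  have : T / 4 <= fejer T 0 by apply: fejer_ge; rewrite normr0 invr_ge0 ltW.
  by apply: le_trans; rewrite divr_ge0 ?ltW.
rewrite fejerE// divr_ge0 ?subr_ge0 ?cos_le1//.
by rewrite mulr_ge0 ?sqr_ge0 ?ltW.
Qed.

Lemma fejer_le (x : R) : x != 0 -> fejer T x <= 2 / (T * x ^+ 2).
Proof.
move=> x0; have Tx : 0 < T * x ^+ 2 by rewrite pmulr_rgt0// exprn_even_gt0.
rewrite fejerE// ler_pM2r ?invr_gt0//.
by have := cos_geN1 (x * T); lra.
Qed.

Lemma measurable_fejer : measurable_fun [set: R] (fejer T).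
Proof.
(* The point [0] is split off by a measurable test; elsewhere the closed form applies, its inverse
   written as the real power [-1]. *)
rewrite (_ : fejer T = fun x => if x == 0 then fejer T 0
  else (1 - cos (x * T)) * (T * x ^+ 2) `^ (-1)).
  apply: measurable_fun_ifT => //.
    exact: measurable_fun_eqr.
  apply: measurable_funM.
    apply: measurable_funB => //.
    by apply: measurable_fun_cos; exact: measurable_funM.
  apply: (@measurableT_comp _ _ _ _ _ _ (@powR R ^~ (-1))) => //.
  by apply: measurable_funM.
apply/funext => x; case: eqVneq => [->//|x0].
by rewrite fejerE// powR_inv1// mulr_ge0 ?sqr_ge0 ?ltW.
Qed.
End fejer.

Lemma integrable_prob d (T : measurableType d) (R : realType)
    (mu : probability T R) (f : T -> R) (L : R) :
  measurable_fun setT f -> (forall x, `|f x| <= L) -> mu.-integrable setT (EFin \o f).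
Proof.
move=> mf fL; apply: (@bounded_integrable _ _ _ _ _ _ L) => //.
exact: le_lt_trans (probability_le1 mu measurableT) (ltry _).
Qed.

Lemma fine_probability_setT d (T : measurableType d) (R : realType)
    (mu : probability T R) : fine (mu [set: T]) = 1.
Proof. exact: (congr1 fine (@probability_setT _ _ _ mu)). Qed.

Lemma sin_lipschitz (R : realType) (x y : R) : `|sin x - sin y| <= `|x - y|.
Proof.
wlog yx : x y / y <= x => [H|].
  by have [/H//|/ltW/H] := leP y x; rewrite distrC (distrC x).
have [|c _ ->] := @MVT_segment R sin cos y x yx.
- by apply: derivable_within_continuous => t _; exact: derivable_sin.
- by rewrite normrM ler_piMl// cos_max.
Qed.

Lemma lebesgue_segment_ltoo (R : realType) (a b : R) (x y : bool) :
  (lebesgue_measure [set` Interval (BSide x a) (BSide y b)] < +oo :> \bar R)%E.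
Proof. by rewrite lebesgue_measure_itv/=; case: ifPn => // _; rewrite -EFinB ltry. Qed.

(** * Fejer averages expressed through Fourier transforms *)

Section fejer_fourier.
Context {R : realType}.
Variable T : R.
Hypothesis T0 : 0 < T.
Notation leb := (@lebesgue_measure R).

Let measurable_weight d (A : measurableType d) (D : set A) (f : A -> R) :
  measurable_fun D f -> measurable_fun D (fun z => 1 - f z / T).
Proof.
move=> mf; apply: measurable_funB => //.
by apply: measurable_funM.
Qed.

Lemma integral_fejer_prob (mu : probability R R) (y : R) :
  \int[mu]_x fejer T (x - y) =
  \int[leb]_(t in `[0, T]) ((1 - t / T) * \int[mu]_x cos ((x - y) * t)).
Proof.
pose k (z : R * R) : R := (1 - z.2 / T) * cos ((z.1 - y) * z.2).
have mk : measurable_fun setT k.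
  apply: measurable_funM; first exact: measurable_weight.
  apply: measurable_fun_cos; apply: measurable_funM => //.
  by apply: measurable_funB.
have := @Rintegral_Fubini _ _ _ _ R mu leb setT `[0, T]%classic k 1.
rewrite {2}/k /fejer => ->//.
- apply: eq_Rintegral => t _; rewrite /k /=; rewrite RintegralZl//.
  apply: (@integrable_prob _ _ _ _ _ 1); last by move=> x; exact: cos_max.
  apply: measurable_fun_cos; apply: measurable_funM => //.
  by apply: measurable_funB.
- exact: le_lt_trans (probability_le1 mu measurableT) (ltry _).
- exact: lebesgue_segment_ltoo.
- move=> x t _ /=; rewrite in_itv /= => tT; rewrite /k /= normrM.
  have /andP[w0 w1] := weight_ge0 T0 tT.
  by rewrite -[leRHS]mulr1 ler_pM// ?cos_max// ger0_norm.
Qed.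

Lemma integral_cos (a b t : R) : a <= b -> t != 0 ->
  \int[leb]_(x in `[a, b]) cos (x * t) = (sin (b * t) - sin (a * t)) / t.
Proof.
move=> ab t0; pose F (x : R) : R := sin (x * t) / t.
have dF (x : R) : is_derive x 1 F (cos (x * t)).
  by apply: is_derive_eq; rewrite /GRing.scale /=; field.
by rewrite (Rintegral_derive ab (fun x _ => dF x))// /F -mulrBl.
Qed.

(** Integrating the cosine in [x] first produces the divided difference of sines; []0, T]] leaves
    out [t = 0], where [integral_cos] does not apply. *)
Lemma integral_fejer_itv (a b : R) : a <= b ->
  \int[leb]_(x in `[a, b]) fejer T x =
  \int[leb]_(t in `]0, T]) ((1 - t / T) * ((sin (b * t) - sin (a * t)) / t)).
Proof.
move=> ab; pose k (z : R * R) : R := (1 - z.2 / T) * cos (z.1 * z.2).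
have mk : measurable_fun setT k.
  apply: measurable_funM; first exact: measurable_weight.
  by apply: measurable_fun_cos; apply: measurable_funM.
have kT x : \int[leb]_(t in `]0, T]) k (x, t) = fejer T x.
  rewrite /fejer -Rintegral_itv_obnd_cbnd//.
  apply: integrableS (fejer_integrable T x) => //.
  by move=> t /=; rewrite !in_itv/= => /andP[/ltW-> ->].
have := @Rintegral_Fubini _ _ _ _ R leb leb `[a, b]%classic `]0, T]%classic k 1.
under eq_Rintegral do rewrite kT.
move=> ->//; last 3 first.
- exact: lebesgue_segment_ltoo.
- exact: lebesgue_segment_ltoo.
- move=> x t _ /=; rewrite in_itv /= => /andP[t0 tT]; rewrite /k /= normrM.
  have /andP[w0 w1] : 0 <= 1 - t / T <= 1 by apply: weight_ge0; rewrite ?tT ?ltW.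
  by rewrite -[leRHS]mulr1 ler_pM// ?cos_max// ger0_norm.
apply: eq_Rintegral => t; rewrite inE /= in_itv /= => /andP[t0 tT].
rewrite /k /= RintegralZl//; first by rewrite integral_cos// gt_eqF.
exact: derivable_integrable.
Qed.

(** Fubini applies although [1 / t] is unbounded: the sine is 1-Lipschitz, so the divided difference
    never exceeds [b - a]. *)
Lemma integral_prob_fejer_itv (mu : probability R R) (a b : R) : a <= b ->
  \int[mu]_u \int[leb]_(x in `[a - u, b - u]) fejer T x =
  \int[leb]_(t in `]0, T]) ((1 - t / T) / t *
    (\int[mu]_u sin ((b - u) * t) - \int[mu]_u sin ((a - u) * t))).
Proof.
move=> ab; pose k (z : R * R) : R := (1 - z.2 / T) *
  ((sin ((b - z.1) * z.2) - sin ((a - z.1) * z.2)) * z.2 `^ (-1)).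
have mk : measurable_fun setT k.
  apply: measurable_funM; first exact: measurable_weight.
  apply: measurable_funM; last first.
    by apply: (@measurableT_comp _ _ _ _ _ _ (@powR R ^~ (-1))).
  by apply: measurable_funB; apply: measurable_fun_sin;
     apply: measurable_funM => //; apply: measurable_funB.
transitivity (\int[mu]_u \int[leb]_(t in `]0, T]) k (u, t)).
  apply: eq_Rintegral => u _; rewrite integral_fejer_itv; last by rewrite lerB.
  apply: eq_Rintegral => t; rewrite inE /= in_itv /= => /andP[t0 tT].
  by rewrite /k /= powR_inv1 ?ltW.
rewrite (@Rintegral_Fubini _ _ _ _ R mu leb setT `]0, T]%classic k (b - a))//.
- apply: eq_Rintegral => t; rewrite inE /= in_itv /= => /andP[t0 tT].
  have ms c : measurable_fun [set: R] (fun u => sin ((c - u) * t)).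
    by apply: measurable_fun_sin; apply: measurable_funM => //; exact: measurable_funB.
  have int_sin c : mu.-integrable setT (EFin \o (fun u => sin ((c - u) * t))).
    by apply: (@integrable_prob _ _ _ _ _ 1) => // x; exact: sin_max.
  rewrite -RintegralB// -RintegralZl//; last first.
    apply: (@integrable_prob _ _ _ _ _ (1 + 1)); first exact: measurable_funB.
    by move=> x; rewrite (le_trans (ler_normB _ _))// lerD ?sin_max.
  by apply: eq_Rintegral => u _; rewrite /k /= powR_inv1 ?ltW//; ring.
- exact: le_lt_trans (probability_le1 mu measurableT) (ltry _).
- exact: lebesgue_segment_ltoo.
- move=> u t _ /=; rewrite in_itv /= => /andP[t0 tT].
  have /andP[w0 w1] : 0 <= 1 - t / T <= 1 by apply: weight_ge0; rewrite ?tT ?ltW.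
  rewrite /k /= (powR_inv1 (ltW t0)) normrM -[leRHS]mul1r ler_pM//.
    by rewrite ger0_norm.
  rewrite normrM normfV (gtr0_norm t0) ler_pdivrMr//.
  apply: le_trans (sin_lipschitz _ _) _.
  rewrite -mulrBl normrM (gtr0_norm t0) opprD addrACA subrr addr0 ger0_norm//.
  by rewrite subr_ge0.
Qed.

End fejer_fourier.

(** * Tails and integrability of the Fejer kernel *)

Lemma integral_inv_sqr_tail (R : realType) (C h : R) : 0 <= C -> 0 < h ->
  (\int[lebesgue_measure]_(x in `[h, +oo[) (C / x ^+ 2)%:E = (C / h)%:E)%E.
Proof.
move=> C0 h0; pose F (x : R) : R := - (C * x^-1).
have dF (x : R) : h <= x -> is_derive x 1 F (C / x ^+ 2).
  move=> hx; have x0 : x != 0 by rewrite gt_eqF// (lt_le_trans h0).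
  have ? : is_derive x 1 (fun y : R => y^-1) (- x ^- 2).
    by have := @is_deriveV _ id x 1 1 x0 (is_derive_id _ _); rewrite scaler1.
  by apply: is_derive_eq; rewrite /GRing.scale /=; field.
have cF x : h <= x -> {for x, continuous F}.
  move=> /dF[? _]; apply: differentiable_continuous.
  exact/derivable1_diffP.
rewrite (@ge0_continuous_FTC2y _ _ F h 0).
- by rewrite -EFinD sub0r opprK.
- by move=> x hx; rewrite divr_ge0 ?sqr_ge0.
- apply: derivable_within_continuous => x; rewrite in_itv /= andbT => hx.
  have x0 : x != 0 by rewrite gt_eqF// (lt_le_trans h0).
  have x20 : x ^+ 2 != 0 by rewrite expf_neq0.
  have ? : is_derive x 1 (fun y : R => (y ^+ 2)^-1) (- (x ^+ 2) ^- 2 *: (2 * x)).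
    apply: (@is_deriveV _ (fun y => y ^+ 2)) => //.
    by apply: is_derive_eq; rewrite /GRing.scale /=; ring.
  exact: ex_derive.
- rewrite (_ : 0 = - (C * 0)); last by rewrite mulr0 oppr0.
  apply: cvgN; apply: cvgMl_tmp; apply/gtr0_cvgV0; last exact: cvg_id.
  exact: nbhs_pinfty_gt.
- by move=> x /ltW/dF[].
- by apply: cvg_at_right_filter; exact: cF.
- move=> x; rewrite in_itv /= andbT => /ltW/dF[? dFx].
  by rewrite derive1E.
Qed.

Lemma integral_inv_sqr_tailN (R : realType) (C h : R) : 0 <= C -> 0 < h ->
  (\int[lebesgue_measure]_(x in `]-oo, (- h)%R]) (C / x ^+ 2)%:E = (C / h)%:E)%E.
Proof.
move=> C0 h0; rewrite ge0_integration_by_substitutionNy.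
- rewrite -integral_inv_sqr_tail//; apply: eq_integral => x _ /=.
  by rewrite sqrrN.
- apply: derivable_within_continuous => x; rewrite in_itv /= => hx.
  have x0 : x != 0 by rewrite lt_eqF// (le_lt_trans hx)// oppr_lt0.
  have x20 : x ^+ 2 != 0 by rewrite expf_neq0.
  have ? : is_derive x 1 (fun y : R => (y ^+ 2)^-1) (- (x ^+ 2) ^- 2 *: (2 * x)).
    apply: (@is_deriveV _ (fun y => y ^+ 2)) => //.
    by apply: is_derive_eq; rewrite /GRing.scale /=; ring.
  exact: ex_derive.
- by move=> x _; rewrite divr_ge0 ?sqr_ge0.
Qed.

Section fejer_tail.
Context {R : realType}.
Variable T : R.
Hypothesis T0 : 0 < T.
Notation leb := (@lebesgue_measure R).

Let fejer_le_tail x : x != 0 -> fejer T x <= 2 / T / x ^+ 2.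
Proof. by move=> x0; rewrite -mulrA -invfM fejer_le. Qed.

Lemma fejer_tail (h : R) : 0 < h ->
  (\int[leb]_(x in `[h, +oo[) (fejer T x)%:E <= (2 / (T * h))%:E)%E.
Proof.
move=> h0; have -> : 2 / (T * h) = 2 / T / h by rewrite -mulrA -invfM.
rewrite -integral_inv_sqr_tail// ?divr_ge0// ?(ltW T0)//.
apply: ge0_le_integral => //.
- by move=> x _; rewrite lee_fin fejer_ge0.
- apply/measurable_EFinP; apply: measurable_funTS; exact: measurable_fejer.
- apply/measurable_EFinP; apply: measurable_funTS.
  rewrite (_ : (fun x => _) = fun x => 2 / T * (x ^+ 2) `^ (-1)); last first.
    by apply/funext => x; rewrite powR_inv1 ?sqr_ge0.
  apply: measurable_funM => //.
  by apply: (@measurableT_comp _ _ _ _ _ _ (@powR R ^~ (-1))).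
- move=> x /=; rewrite in_itv /= andbT lee_fin => hx.
  by rewrite fejer_le_tail// gt_eqF// (lt_le_trans h0).
Qed.

Lemma fejer_tailN (h : R) : 0 < h ->
  (\int[leb]_(x in `]-oo, (- h)%R]) (fejer T x)%:E <= (2 / (T * h))%:E)%E.
Proof.
move=> h0; have -> : 2 / (T * h) = 2 / T / h by rewrite -mulrA -invfM.
rewrite -integral_inv_sqr_tailN// ?divr_ge0// ?(ltW T0)//.
apply: ge0_le_integral => //.
- by move=> x _; rewrite lee_fin fejer_ge0.
- apply/measurable_EFinP; apply: measurable_funTS; exact: measurable_fejer.
- apply/measurable_EFinP; apply: measurable_funTS.
  rewrite (_ : (fun x => _) = fun x => 2 / T * (x ^+ 2) `^ (-1)); last first.
    by apply/funext => x; rewrite powR_inv1 ?sqr_ge0.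
  apply: measurable_funM => //.
  by apply: (@measurableT_comp _ _ _ _ _ _ (@powR R ^~ (-1))).
- move=> x /=; rewrite in_itv /= lee_fin => hx.
  by rewrite fejer_le_tail// lt_eqF// (le_lt_trans hx)// oppr_lt0.
Qed.

Lemma fejer_le_T (x : R) : fejer T x <= T.
Proof.
rewrite /fejer; apply: (@le_trans _ _ (\int[leb]_(t in `[0, T]) 1)).
  apply: le_Rintegral => //; [exact: fejer_integrable|exact: derivable_integrable|].
  move=> t /=; rewrite in_itv /= => tT; have /andP[w0 w1] := weight_ge0 T0 tT.
  by rewrite -[leRHS]mulr1 (le_trans (ler_wpM2l w0 (cos_le1 _)))// !mulr1.
by rewrite Rintegral_cst//= mul1r lebesgue_measure_itv /= lte_fin T0 oppr0 addr0.
Qed.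

Lemma integrable_fejer : leb.-integrable setT (EFin \o fejer T).
Proof.
have mf : measurable_fun setT (EFin \o fejer T).
  by apply/measurable_EFinP; exact: measurable_fejer.
have f0 x : (0 <= (EFin \o fejer T) x)%E by rewrite lee_fin fejer_ge0.
apply/integrableP; split => //.
under eq_integral do rewrite gee0_abs//.
have RE : [set: R] = `]-oo, (-1)%R] `|` (`](-1)%R, 1%R[ `|` `[1%R, +oo[).
  apply/esym/seteqP; split => // x _ /=; rewrite !in_itv /= andbT.
  have [|x1] := leP x (-1); first by left.
  by have [|] := leP 1 x; [right; right|right; left].
rewrite RE ge0_integral_setU//; last 3 first.
- exact: measurableU.
- exact: measurable_funTS.
- apply/disj_setPS => x [/=]; rewrite in_itv /= => x1 [|]; rewrite in_itv /=.
    by rewrite ltNge x1.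
  by rewrite andbT => x2; move: (le_trans x2 x1); lra.
rewrite ge0_integral_setU//; last 2 first.
- exact: measurable_funTS.
- apply/disj_setPS => x [/=]; rewrite !in_itv /= => /andP[_ x1].
  by rewrite leNgt x1.
apply: lte_add_pinfty.
  by apply: le_lt_trans (fejer_tailN ltr01) (ltry _).
apply: lte_add_pinfty; last by apply: le_lt_trans (fejer_tail ltr01) (ltry _).
apply: (@le_lt_trans _ _ (\int[leb]_(x in `](-1)%R, 1%R[) T%:E)%E).
  apply: ge0_le_integral => //; first exact: measurable_funTS.
  by move=> x _; rewrite lee_fin fejer_le_T.
rewrite integral_cst// lte_mul_pinfty// ?lee_fin ?(ltW T0)//.
exact: lebesgue_segment_ltoo.
Qed.

End fejer_tail.

(** * Esseen's inequality *)

(** Attached to a law and real-valued, so that differences and linear arithmetic apply directly. *)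
Definition cdfR (R : realType) (mu : probability R R) (x : R) : R :=
  fine (mu `]-oo, x]%classic).

Section cdfR.
Context {R : realType}.
Variable mu : probability R R.

Lemma probability_fin_num (A : set R) : measurable A -> mu A \is a fin_num.
Proof. by move=> mA; exact: fin_num_measure. Qed.

Lemma cdfR_ge0 x : 0 <= cdfR mu x.
Proof. by rewrite /cdfR fine_ge0. Qed.

Lemma cdfR_le1 x : cdfR mu x <= 1.
Proof.
rewrite -lee_fin /cdfR fineK; last exact: probability_fin_num.
exact: probability_le1.
Qed.

Lemma cdfRB x y : x <= y -> cdfR mu y - cdfR mu x = fine (mu `]x, y]%classic).
Proof.
move=> xy; apply/eqP; rewrite subr_eq addrC /cdfR -fineD ?probability_fin_num//.
rewrite -measureU//.
  by rewrite -itv_bndbnd_setU// bnd_simp.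
apply/eqP; rewrite -disj_set2E; apply/disj_setPS => z [/=].
by rewrite !in_itv /= => zx /andP[]; rewrite ltNge zx.
Qed.

Lemma cdfR_nd : {homo cdfR mu : x y / x <= y}.
Proof. by move=> x y xy; rewrite -subr_ge0 cdfRB// fine_ge0. Qed.

Lemma measurable_cdfR : measurable_fun [set: R] (cdfR mu).
Proof. exact: (nondecreasing_measurable _ cdfR_nd). Qed.

End cdfR.

(** Supplies the left base point of the increments, where both distribution functions are
    negligible. *)
Lemma cdfR_small d (T : measurableType d) (R : realType) (P : probability T R)
    (X : {RV P >-> R}) (e : R) : 0 < e ->
  exists z : R, forall x : R, x <= z -> cdfR (distribution P X) x <= e.
Proof.
move=> e0; have /fine_cvgP[_ /cvgrPdist_lt/(_ e e0)] := @cvg_cdfNy0 _ _ _ _ X.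
move=> [M [_ HM]]; exists (M - 1) => x xM.
have := HM x (le_lt_trans xM _); rewrite sub0r normrN => H.
by apply: le_trans (ler_norm _) (ltW (H _)); rewrite ltrBlDr ltrDl.
Qed.

Section smoothing.
Context {R : realType}.
Variable T : R.
Hypothesis T0 : 0 < T.
Notation leb := (@lebesgue_measure R).

Lemma integrable_fejerM (f : R -> R) (L : R) :
  measurable_fun setT f -> (forall x, `|f x| <= L) ->
  leb.-integrable setT (EFin \o (fun x => fejer T x * f x)).
Proof.
move=> mf fL.
have iL : leb.-integrable setT (fun x => (EFin \o fejer T) x * L%:E)%E.
  by apply: integrableZr => //; exact: integrable_fejer.
apply: le_integrable iL => //.
- apply/measurable_EFinP; apply: measurable_funM => //; exact: measurable_fejer.
- move=> x _ /=; rewrite lee_fin !normrM ler_wpM2l//.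
  by rewrite (le_trans (fL x))// ler_norm.
Qed.

(** The integrand dominates [g1 - L (g2 + g3)]. For [|x| <= 1 / T] the kernel is at least [T / 4] on
    a length [2 / T], which yields [q / 2]; up to [h] the integrand is nonnegative; beyond [h] the
    function may drop to [- L], at the cost of two tails of mass at most [2 / (T h)]. *)
Lemma fejer_smoothing_ge (f : R -> R) (L q h : R) :
  measurable_fun setT f -> (forall x, `|f x| <= L) -> 0 <= q -> T^-1 <= h ->
  (forall x, `|x| <= h -> q <= f x) ->
  q / 2 <= \int[leb]_x (fejer T x * f x) + 4 * L / (T * h).
Proof.
move=> mf fL q0 Th fq; have h0 : 0 < h by rewrite (lt_le_trans _ Th)// invr_gt0.
have L0 : 0 <= L by exact: le_trans (fL 0).
pose g1 : R -> R := (fun=> q * T / 4) \_ `[- T^-1, T^-1].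
pose g2 : R -> R := (fejer T) \_ `[h, +oo[.
pose g3 : R -> R := (fejer T) \_ `]-oo, - h].
have i1 : leb.-integrable setT (EFin \o g1).
  rewrite /g1 -restrict_EFin; apply/integrable_restrict => //; rewrite setTI.
  by apply: (@bounded_integrable _ _ _ _ _ _ `|q * T / 4|) => //; exact: lebesgue_segment_ltoo.
have i2 : leb.-integrable setT (EFin \o g2).
  rewrite /g2 -restrict_EFin; apply/integrable_restrict => //; rewrite setTI.
  by apply: integrableS (integrable_fejer T0).
have i3 : leb.-integrable setT (EFin \o g3).
  rewrite /g3 -restrict_EFin; apply/integrable_restrict => //; rewrite setTI.
  by apply: integrableS (integrable_fejer T0).
have i23 : leb.-integrable setT (EFin \o (fun x => g2 x + g3 x)).
  exact: (integrableD measurableT i2 i3).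
have i23L : leb.-integrable setT (EFin \o (fun x => L * (g2 x + g3 x))).
  exact: (@integrableZl _ _ _ leb setT measurableT L _ i23).
have -> : q / 2 = \int[leb]_x g1 x.
  rewrite /g1 -Rintegral_mkcond Rintegral_cst//= lebesgue_measure_itv /= lte_fin.
  have iT : 0 < T^-1 by rewrite invr_gt0.
  rewrite (_ : - T^-1 < T^-1); last by lra.
  by rewrite /=; field; rewrite gt_eqF.
have b2 : \int[leb]_x g2 x <= 2 / (T * h).
  rewrite /g2 -Rintegral_mkcond -lee_fin /Rintegral fineK; last first.
    by apply: integrable_fin_num => //; apply: integrableS (integrable_fejer T0).
  exact: fejer_tail.
have b3 : \int[leb]_x g3 x <= 2 / (T * h).
  rewrite /g3 -Rintegral_mkcond -lee_fin /Rintegral fineK; last first.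
    by apply: integrable_fin_num => //; apply: integrableS (integrable_fejer T0).
  exact: fejer_tailN.
have fg x : g1 x - L * (g2 x + g3 x) <= fejer T x * f x.
  have f0 := fejer_ge0 T0 x; have := fL x; rewrite ler_norml => /andP[fx _].
  have fLx : - L * fejer T x <= fejer T x * f x by rewrite mulrC ler_wpM2l.
  have g20 : 0 <= g2 x by rewrite /g2 patchE; case: ifP.
  have g30 : 0 <= g3 x by rewrite /g3 patchE; case: ifP.
  have [xT|xT] := leP `|x| T^-1.
    have -> : g1 x = q * T / 4 by rewrite /g1 patchE mem_set//= in_itv /= -ler_norml.
    apply: (@le_trans _ _ (q * T / 4)).
      by rewrite lerBlDr lerDl mulr_ge0// addr_ge0.
    apply: le_trans (ler_wpM2l f0 (fq _ (le_trans xT Th))).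
    by rewrite -mulrA [leRHS]mulrC ler_wpM2l// fejer_ge.
  have -> : g1 x = 0.
    rewrite /g1 patchE memNset//= in_itv /= -ler_norml.
    by apply/negP; rewrite -ltNge.
  rewrite sub0r.
  have [xh|xh] := leP `|x| h.
    apply: (@le_trans _ _ 0); first by rewrite oppr_le0 mulr_ge0// addr_ge0.
    by rewrite mulr_ge0// (le_trans q0)// fq.
  suff : fejer T x <= g2 x + g3 x.
    move=> H; have := ler_wpM2l L0 H; lra.
  have [x0|x0] := leP 0 x.
    have -> : g2 x = fejer T x.
      rewrite ger0_norm// in xh.
      by rewrite /g2 patchE mem_set//= in_itv /= andbT ltW.
    by rewrite lerDl.
  have -> : g3 x = fejer T x.
    rewrite /g3 patchE mem_set//= in_itv /=; rewrite ltr0_norm// in xh.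
    by rewrite lerNr ltW.
  by rewrite lerDr.
have := @le_Rintegral _ _ _ leb setT _ (fun x => fejer T x * f x) measurableT
  (integrableB measurableT i1 i23L) (integrable_fejerM mf fL) (fun x _ => fg x).
rewrite RintegralB// RintegralZl// RintegralD// => H.
have : L * (\int[leb]_x g2 x + \int[leb]_x g3 x) <= 4 * L / (T * h).
  rewrite (_ : 4 * L / _ = L * (2 / (T * h) + 2 / (T * h))); last by ring.
  exact: ler_wpM2l (lerD b2 b3).
by move=> ?; rewrite -lerBlDr (le_trans _ H)// lerB.
Qed.

End smoothing.

(** The increment [F (b - x) - F (a - x)] is the [mu]-mass of the [u] with [a < x + u <= b]. Both
    sides integrate the nonnegative kernel over this strip [E], in the two possible orders. *)
Lemma integral_fejer_cdf (R : realType) (T : R) (mu : probability R R) (a b : R) :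
  0 < T -> a <= b ->
  \int[lebesgue_measure]_x (fejer T x * (cdfR mu (b - x) - cdfR mu (a - x))) =
  \int[mu]_u \int[lebesgue_measure]_(x in `[a - u, b - u]) fejer T x.
Proof.
move=> T0 ab; pose E : set (R * R) := (fun z => z.1 + z.2) @^-1` `]a, b].
have mE : measurable E.
  rewrite -[E]setTI /E.
  have : measurable_fun [set: R * R] (fun z : R * R => z.1 + z.2).
    exact: measurable_funD.
  by apply => //.
pose f (z : R * R) : \bar R := (fejer T z.1 * \1_E z)%:E.
have mf : measurable_fun setT f.
  apply/measurable_EFinP; apply: measurable_funM => //.
  by apply: (measurableT_comp (measurable_fejer T0)).
have f0 z : (0 <= f z)%E by rewrite lee_fin mulr_ge0// fejer_ge0.
have fxu x u : f (x, u) = ((fejer T x)%:E * (\1_(`]a - x, b - x]%classic) u)%:E)%E.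
  rewrite -EFinM /f /=; congr (_ * _)%:E; rewrite !indicE; congr (_%:R).
  congr nat_of_bool; apply/idP/idP; rewrite !inE /E /= !in_itv /=.
    by rewrite ltrBlDl lerBrDl.
  by rewrite ltrBlDl lerBrDl.
have fux x u : f (x, u) = ((EFin \o fejer T) \_ `]a - u, b - u]) x.
  rewrite patchE /f /= indicE; case: ifPn => [|] xu.
    have -> : (x, u) \in E.
      by move: xu; rewrite !inE /E /= !in_itv /= ltrBlDr lerBrDr.
    by rewrite mulr1.
  have -> : ((x, u) \in E) = false.
    by apply/negbTE; apply: contra xu; rewrite !inE /E /= !in_itv /= ltrBlDr lerBrDr.
  by rewrite mulr0.
rewrite /Rintegral; congr fine.
transitivity (\int[lebesgue_measure]_x \int[mu]_u f (x, u))%E.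
  apply: eq_integral => x _; under eq_integral do rewrite fxu.
  rewrite ge0_integralZl//; last 2 first.
  - by apply/measurable_EFinP.
  - by rewrite lee_fin fejer_ge0.
  rewrite integral_indic// setIT EFinM cdfRB ?lerB//.
  by congr (_ * _)%E; apply: fineK; exact: probability_fin_num.
rewrite fubini_tonelli//; apply: eq_integral => u _.
have iF : lebesgue_measure.-integrable `]a - u, b - u] (EFin \o fejer T).
  by apply: integrableS (integrable_fejer T0).
transitivity (\int[lebesgue_measure]_(x in `](a - u)%R, (b - u)%R]) (fejer T x)%:E)%E.
  by rewrite [RHS]integral_mkcond; apply: eq_integral => x _; exact: fux.
rewrite -integral_itv_obnd_cbnd; last exact: measurable_int iF.
by rewrite fineK//; exact: integrable_fin_num.
Qed.

Section esseen.
Context {R : realType}.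
Variables (d1 d2 : measure_display) (T1 : measurableType d1) (T2 : measurableType d2).
Variables (P1 : probability T1 R) (P2 : probability T2 R).
Variables (X1 : {RV P1 >-> R}) (X2 : {RV P2 >-> R}).
Local Notation mu1 := (distribution P1 X1).
Local Notation mu2 := (distribution P2 X2).
Variables (T S kappa : R).
Hypothesis T0 : 0 < T.
Hypothesis S0 : 0 <= S.
Let D x := cdfR mu1 x - cdfR mu2 x.
(** The factor [32] makes the tail error [4 * (2 * eta) / (T * h)] equal to [eta / 4]. Since
    [fejer_smoothing_ge] controls [q / 2], this becomes [eta / 2] in the end, which can still be
    absorbed. *)
Let h := 32 / T.
Hypothesis conc : forall x, cdfR mu2 (x + 2 * h) - cdfR mu2 x <= kappa.
Hypothesis smooth : forall a b : R, a <= b ->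
  `|\int[lebesgue_measure]_x (fejer T x * (D (b - x) - D (a - x)))| <= S.

Let h0 : 0 < h. Proof. by rewrite divr_gt0. Qed.

Let Th : T^-1 <= h.
Proof. by rewrite ler_peMl ?invr_ge0 ?(ltW T0) ?ler1n. Qed.

Let measurable_D c : measurable_fun [set: R] (fun x => D (c - x)).
Proof.
have mB : measurable_fun [set: R] (fun x : R => c - x) by exact: measurable_funB.
by apply: measurable_funB; apply: (measurableT_comp (measurable_cdfR _) mB).
Qed.

Let D_le1 x : `|D x| <= 1.
Proof.
have := cdfR_ge0 mu1 x; have := cdfR_ge0 mu2 x.
have := cdfR_le1 mu1 x; have := cdfR_le1 mu2 x.
rewrite /D ler_norml; move: (cdfR mu1 x) (cdfR mu2 x) => u v ? ? ? ?; lra.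
Qed.

Let TLh (eta : R) : 4 * (2 * eta) / (T * h) = eta / 4.
Proof. by rewrite /h; field; rewrite gt_eqF. Qed.

(** A large value of [D] persists on one side. On [[x, x + 2 h]] the first distribution function
    only grows and the second gains at most [kappa], so [D] stays above [D x - kappa]; this window
    is centred at [x + h]. A very negative value persists in the same way on [[x - 2 h, x]], centred
    at [x - h]. *)
Let esseen_step (eta : R) : (forall x, `|D x| <= eta) ->
  forall x, `|D x| <= kappa + 2 * S + eta / 2.
Proof.
move=> De x; have eta0 : 0 <= eta by exact: le_trans (De 0).
have B2 (b a y : R) : `|D (b - y) - D (a - y)| <= 2 * eta.
  by rewrite (le_trans (ler_normB _ _))// mulr_natl mulr2n lerD.
apply/ler_addgt0Pr => e e0.
have [z1 Hz1] := cdfR_small X1 e0; have [z2 Hz2] := cdfR_small X2 e0.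
(* At most [x - h], so that the increments taken below are ordered, and [h] below [z1] and [z2], so
   that [a - y] lies left of both whenever [|y| <= h]. *)
pose a : R := Num.min (x - h) (Num.min z1 z2 - h).
have ax : a <= x - h by rewrite /a ge_min lexx.
have az : a <= Num.min z1 z2 - h by rewrite /a ge_min lexx orbT.
have az1 (y : R) : `|y| <= h -> a - y <= z1.
  have : Num.min z1 z2 <= z1 by rewrite ge_min lexx.
  by move: az; rewrite ler_norml => + + /andP[+ +]; move: (Num.min z1 z2) => *; lra.
have az2 (y : R) : `|y| <= h -> a - y <= z2.
  have : Num.min z1 z2 <= z2 by rewrite ge_min lexx orbT.
  by move: az; rewrite ler_norml => + + /andP[+ +]; move: (Num.min z1 z2) => *; lra.
have conc' (y y' : R) : y' <= y + 2 * h -> cdfR mu2 y' <= cdfR mu2 y + kappa.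
  move=> /(cdfR_nd mu2) yy'; rewrite (le_trans yy')//.
  by rewrite -lerBlDl conc.
rewrite ler_norml; apply/andP; split.
- rewrite lerNl; have [qneg|q0] := leP (- D x - kappa - e) 0.
    by move: qneg S0 eta0; rewrite /=; move: (D x) => w *; lra.
  have xa : a <= x - h by [].
  pose f (y : R) : R := - (D (x - h - y) - D (a - y)).
  have mf : measurable_fun setT f.
    by apply: measurableT_comp => //; exact: measurable_funB.
  have fL (y : R) : `|f y| <= 2 * eta by rewrite normrN.
  have fq (y : R) : `|y| <= h -> - D x - kappa - e <= f y.
    move=> yh; rewrite /f.
    have := Hz2 _ (az2 _ yh); have := cdfR_ge0 mu1 (a - y).
    move: yh; rewrite ler_norml => /andP[y1 y2].
    have : cdfR mu1 (x - h - y) <= cdfR mu1 x by apply: cdfR_nd; lra.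
    have : cdfR mu2 x <= cdfR mu2 (x - h - y) + kappa by apply: conc'; lra.
    rewrite /D; move: (cdfR _ _) (cdfR _ _) (cdfR _ _).
    by move: (cdfR _ _) (cdfR _ _) (cdfR _ _) => *; lra.
  have := fejer_smoothing_ge T0 mf fL (ltW q0) Th fq; rewrite TLh.
  have := smooth xa; rewrite ler_norml => /andP[].
  have -> : \int[lebesgue_measure]_y (fejer T y * f y) =
            - \int[lebesgue_measure]_y (fejer T y * (D (x - h - y) - D (a - y))).
    rewrite -mulN1r -RintegralZl//.
      by apply: eq_Rintegral => y _; rewrite /f; ring.
    by apply: integrable_fejerM => //; exact: measurable_funB.
  by move: (\int[_]_y _) (D x) => I w *; lra.
- have [qneg|q0] := leP (D x - kappa - e) 0.
    by move: qneg S0 eta0; rewrite /=; move: (D x) => w *; lra.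
  have xa : a <= x + h by rewrite (le_trans ax)// lerD2l; move: h0; lra.
  pose f (y : R) : R := D (x + h - y) - D (a - y).
  have mf : measurable_fun setT f by exact: measurable_funB.
  have fL (y : R) : `|f y| <= 2 * eta by exact: B2.
  have fq (y : R) : `|y| <= h -> D x - kappa - e <= f y.
    move=> yh; rewrite /f.
    have := Hz1 _ (az1 _ yh); have := cdfR_ge0 mu2 (a - y).
    move: yh; rewrite ler_norml => /andP[y1 y2].
    have : cdfR mu1 x <= cdfR mu1 (x + h - y) by apply: cdfR_nd; lra.
    have : cdfR mu2 (x + h - y) <= cdfR mu2 x + kappa by apply: conc'; lra.
    rewrite /D; move: (cdfR _ _) (cdfR _ _) (cdfR _ _).
    by move: (cdfR _ _) (cdfR _ _) (cdfR _ _) => *; lra.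
  have := fejer_smoothing_ge T0 mf fL (ltW q0) Th fq; rewrite TLh.
  have := smooth xa; rewrite ler_norml => /andP[].
  by rewrite /f; move: (\int[_]_y _) (D x) => I w *; lra.
Qed.

(** For [eta] the supremum of [|D|], which is finite, [esseen_step] bounds the supremum by
    [kappa + 2 S] plus half of itself. *)
Lemma esseen_inequality x : `|cdfR mu1 x - cdfR mu2 x| <= 2 * kappa + 4 * S.
Proof.
pose A := [set `|D y| | y in [set: R]].
have A0 : A !=set0 by exists `|D 0|; exists 0.
have Aub : has_ubound A by exists 1 => _ [y _ <-]; exact: D_le1.
have DA y : `|D y| <= sup A by apply: ub_le_sup => //; exists y.
have : sup A <= kappa + 2 * S + sup A / 2.
  by apply: ge_sup => // _ [y _ <-]; exact: esseen_step.
by move=> ?; apply: le_trans (DA x) _; lra.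
Qed.

End esseen.

(** * Stable and compound Poisson laws *)

Lemma fourier_expC (R : realType) (mu : probability R R) (xi : R) (z : R[i]) :
  fourier mu xi = expC z ->
  \int[mu]_x cos (x * xi) = expR (complex.Re z) * cos (complex.Im z) /\
  \int[mu]_x sin (x * xi) = expR (complex.Re z) * sin (complex.Im z).
Proof.
move=> muz; split.
- transitivity (complex.Re (fourier mu xi)); last by rewrite muz.
  apply: eq_Rintegral => x _ /=.
  by rewrite !mul0r !mul1r subr0 add0r expR0 mul1r.
- transitivity (complex.Im (fourier mu xi)); last by rewrite muz.
  apply: eq_Rintegral => x _ /=.
  by rewrite !mul0r !mul1r subr0 add0r expR0 mul1r.
Qed.

Lemma stable_exponentE (R : realType) (c alpha beta xi : R) :
  complex.Re (stable_exponent c alpha beta xi) = - `|c * xi| `^ alpha /\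
  complex.Im (stable_exponent c alpha beta xi) =
    `|c * xi| `^ alpha * (beta * stable_h alpha xi * Num.sg xi).
Proof. by rewrite /stable_exponent /=; split; ring. Qed.

Lemma compound_PoissonE (R : realType) (lambda : R) (phi mu : probability R R) (xi : R) :
  compound_Poisson lambda phi mu ->
  fourier mu xi = expC ((lambda * (\int[phi]_x cos (x * xi) - 1)) +i*
    (lambda * \int[phi]_x sin (x * xi)))%C.
Proof.
move=> /(_ xi) ->; congr expC; rewrite /integralC.
have mcos : measurable_fun [set: R] (fun x => cos (x * xi)).
  by apply: measurable_fun_cos; exact: measurable_funM.
have msin : measurable_fun [set: R] (fun x => sin (x * xi)).
  by apply: measurable_fun_sin; exact: measurable_funM.
have icos : phi.-integrable setT (EFin \o (fun x => cos (x * xi))).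
  by apply: (@integrable_prob _ _ _ _ _ 1) => // x; exact: cos_max.
have isin : phi.-integrable setT (EFin \o (fun x => sin (x * xi))).
  by apply: (@integrable_prob _ _ _ _ _ 1) => // x; exact: sin_max.
have i1 : phi.-integrable setT (EFin \o (fun=> 1 : R)).
  by apply: (@integrable_prob _ _ _ _ _ 1) => // x; rewrite normr1.
have icos1 : phi.-integrable setT (EFin \o (fun x => cos (x * xi) - 1)).
  exact: (integrableB measurableT icos i1).
congr (_ +i* _)%C.
- transitivity (\int[phi]_x (lambda * (cos (x * xi) - 1))).
    apply: eq_Rintegral => x _ /=.
    by rewrite !mul0r !mul1r subr0 add0r expR0 mul1r; ring.
  rewrite RintegralZl// RintegralB// Rintegral_cst// mul1r.
  by rewrite fine_probability_setT.
- transitivity (\int[phi]_x (lambda * sin (x * xi))).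
    apply: eq_Rintegral => x _ /=.
    by rewrite !mul0r !mul1r subr0 add0r expR0 mul1r; ring.
  by rewrite RintegralZl.
Qed.

Section fourier_shift.
Context {R : realType}.
Variables (mu : probability R R) (t a b : R).
Hypothesis Ecos : \int[mu]_x cos (x * t) = expR a * cos b.
Hypothesis Esin : \int[mu]_x sin (x * t) = expR a * sin b.

Let integrable_cos : mu.-integrable setT (EFin \o (fun x => cos (x * t))).
Proof.
apply: (@integrable_prob _ _ _ _ _ 1); last by move=> x; exact: cos_max.
by apply: measurable_fun_cos; exact: measurable_funM.
Qed.

Let integrable_sin : mu.-integrable setT (EFin \o (fun x => sin (x * t))).
Proof.
apply: (@integrable_prob _ _ _ _ _ 1); last by move=> x; exact: sin_max.
by apply: measurable_fun_sin; exact: measurable_funM.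
Qed.

Let integral_comb (p q : R) :
  \int[mu]_x (p * cos (x * t) + q * sin (x * t)) =
  p * (expR a * cos b) + q * (expR a * sin b).
Proof.
rewrite RintegralD//.
- by rewrite !RintegralZl// Ecos Esin.
- exact: (@integrableZl _ _ _ mu setT measurableT p _ integrable_cos).
- exact: (@integrableZl _ _ _ mu setT measurableT q _ integrable_sin).
Qed.

Lemma integral_sin_shift (s : R) :
  \int[mu]_x sin ((s - x) * t) = expR a * sin (s * t - b).
Proof.
transitivity (\int[mu]_x (sin (s * t) * cos (x * t) + - cos (s * t) * sin (x * t))).
  by apply: eq_Rintegral => x _; rewrite mulrBl sinB; ring.
by rewrite integral_comb sinB; ring.
Qed.

Lemma integral_cos_shift (s : R) :
  \int[mu]_x cos ((x - s) * t) = expR a * cos (b - s * t).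
Proof.
transitivity (\int[mu]_x (cos (s * t) * cos (x * t) + sin (s * t) * sin (x * t))).
  by apply: eq_Rintegral => x _; rewrite mulrBl cosB; ring.
by rewrite integral_comb cosB; ring.
Qed.

End fourier_shift.

(** * Second-order estimates for the complex exponential, in real form *)

Section elementary_bounds.
Context {R : realType}.
Implicit Types x y u : R.

Lemma expRN_le x : 0 <= x -> expR (- x) <= 1 - x + x ^+ 2 / 2.
Proof.
move=> x0; pose f (t : R) : R := t ^+ 2 / 2 - t + 1 - expR (- t).
have f' (t : R) : is_derive t 1 f (t - 1 + expR (- t)).
  by apply: is_derive_eq; rewrite /GRing.scale /=; field.
have := derive_ge0_le x0 (fun t _ => f' t).
have -> : f 0 = 0 by rewrite /f oppr0 expR0; ring.
rewrite /f => H.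
have /H : forall t : R, 0 <= t <= x -> 0 <= t - 1 + expR (- t).
  by move=> t _; have := expR_ge1Dx (- t); lra.
by move=> ?; lra.
Qed.

Lemma norm_sinB_le y : `|sin y - y| <= y ^+ 2 / 2.
Proof.
wlog y0 : y / 0 <= y => [H|].
  have [/H//|/ltW y0] := leP 0 y.
  by have := H (- y); rewrite sinN -opprD normrN sqrrN; apply; rewrite oppr_ge0.
rewrite distrC ger0_norm ?subr_ge0 ?sin_le_id//.
pose f (t : R) : R := t ^+ 2 / 2 - t + sin t.
have f' (t : R) : is_derive t 1 f (t - 1 + cos t).
  by apply: is_derive_eq; rewrite /GRing.scale /=; field.
have := derive_ge0_le y0 (fun t _ => f' t).
have -> : f 0 = 0 by rewrite /f sin0; ring.
rewrite /f => H.
have /H : forall t : R, 0 <= t <= y -> 0 <= t - 1 + cos t.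
  (* For [t >= 2] the bound [cos t >= -1] suffices; below [2], [cos_ge] leaves
     [t (2 - t) / 2 >= 0]. *)
  move=> t /andP[t0 _]; have [t2|t2] := leP 2 t.
    by have := cos_geN1 t; lra.
  have t2' : 0 <= t * (2 - t) by rewrite mulr_ge0// subr_ge0 ltW.
  by have := cos_ge t; lra.
by move=> ?; lra.
Qed.

(** Real part of the remainder [exp z - 1 - z] at [z = - x + i y]. *)
Lemma norm_expR_cos_le x y : 0 <= x ->
  `|expR (- x) * cos y - 1 + x| <= (x ^+ 2 + y ^+ 2) / 2.
Proof.
move=> x0; have e0 : 0 < expR (- x) := expR_gt0 _.
have e1 : expR (- x) <= 1 by rewrite -expR0 ler_expR oppr_le0.
have H1 : expR (- x) * cos y <= expR (- x).
  by rewrite ger_pMr// cos_le1.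
have H2 : expR (- x) * (1 - y ^+ 2 / 2) <= expR (- x) * cos y.
  by rewrite ler_pM2l// cos_ge.
have H3 : expR (- x) * (y ^+ 2 / 2) <= y ^+ 2 / 2.
  by rewrite ler_piMl// divr_ge0 ?sqr_ge0.
have H4 := expRN_le x0; have H5 := expR_ge1Dx (- x).
have := sqr_ge0 x; have := sqr_ge0 y.
rewrite ler_norml => *; apply/andP; split; lra.
Qed.

(** Imaginary part of the same remainder: replacing the sine by [y] costs [y^2 / 2], and the damping
    costs [x |y| <= (x^2 + y^2) / 2]. *)
Lemma norm_expR_sin_le x y : 0 <= x ->
  `|expR (- x) * sin y - y| <= y ^+ 2 + x ^+ 2 / 2.
Proof.
move=> x0; have e1 : expR (- x) <= 1 by rewrite -expR0 ler_expR oppr_le0.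
have -> : expR (- x) * sin y - y = (sin y - y) - (1 - expR (- x)) * sin y by ring.
rewrite (le_trans (ler_normB _ _))// normrM.
have H1 := norm_sinB_le y.
have H2 : `|1 - expR (- x)| <= x.
  by rewrite ger0_norm ?subr_ge0// lerBlDr -lerBlDl; exact: expR_ge1Dx.
have H3 : `|sin y| <= `|y|.
  by have := sin_lipschitz y 0; rewrite sin0 !subr0.
have H4 : `|1 - expR (- x)| * `|sin y| <= x * `|y| by rewrite ler_pM.
have H5 : 0 <= (x - `|y|) ^+ 2 by rewrite sqr_ge0.
have := real_normK (num_real y); move: H4 H5 H1.
by move: `|y| (`|1 - expR (- x)| * `|sin y|) `|_| => *; lra.
Qed.

(** Mean value theorem along the segment joining the complex exponents [a1 + i a2] and [b1 + i b2]:
    by convexity the real part stays at most [m] on it. *)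
Lemma norm_expR_sinB_le (a1 a2 b1 b2 m theta : R) : a1 <= m -> b1 <= m ->
  `|expR a1 * sin (theta - a2) - expR b1 * sin (theta - b2)| <=
  (`|a1 - b1| + `|a2 - b2|) * expR m.
Proof.
move=> a1m b1m; pose e1 := a1 - b1; pose e2 := a2 - b2.
pose f (s : R) : R := expR (b1 + s * e1) * sin (theta - (b2 + s * e2)).
pose df (s : R) : R := expR (b1 + s * e1) *
  (e1 * sin (theta - (b2 + s * e2)) - e2 * cos (theta - (b2 + s * e2))).
have f' (s : R) : is_derive s 1 f (df s).
  by apply: is_derive_eq; rewrite /GRing.scale /df /=; ring.
have [|s] := @MVT_segment R f df 0 1 ler01.
  by apply: derivable_within_continuous => s _; have [] := f' s.
rewrite in_itv /= => /andP[s0 s1].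
rewrite subr0 mulr1 /f !mul1r !mul0r !addr0.
rewrite (_ : b1 + e1 = a1) ?/e1 1?addrC ?subrK//.
rewrite (_ : b2 + e2 = a2) ?/e2 1?addrC ?subrK// => ->.
rewrite /df normrM mulrC ler_pM// ?normr_ge0//.
  rewrite (le_trans (ler_normB _ _))// !normrM lerD// ler_piMr//.
    exact: sin_max.
  exact: cos_max.
rewrite gtr0_norm ?expR_gt0// ler_expR /e1.
have -> : b1 + s * (a1 - b1) = s * a1 + (1 - s) * b1 by ring.
have : s * a1 <= s * m by rewrite ler_wpM2l.
have : (1 - s) * b1 <= (1 - s) * m by rewrite ler_wpM2l ?subr_ge0.
by move=> *; lra.
Qed.

(* The Fourier transforms of [Yn] and [Y] are [exp (N (exp (z / N) - 1))] and
   [exp z] with [z = - v + i v w]. *)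
Lemma compound_exponent_diff (N v w theta : R) : 0 < N -> 0 <= v -> v <= N ->
  `|expR (N * (expR (- (v / N)) * cos (v / N * w) - 1)) *
      sin (theta - N * (expR (- (v / N)) * sin (v / N * w))) -
    expR (- v) * sin (theta - v * w)| <=
  2 * v ^+ 2 * (1 + w ^+ 2) / N * expR (- v / 2).
Proof.
move=> N0 v0 vN; set x := v / N.
have x0 : 0 <= x by rewrite divr_ge0// ltW.
have x1 : x <= 1 by rewrite ler_pdivrMr// mul1r.
have vE : v = N * x by rewrite /x mulrCA divff ?mulr1// gt_eqF.
clearbody x; set y := x * w.
have vwE : v * w = N * y by rewrite vE /y mulrA.
(* Here [v <= N] enters: for [x <= 1] the bound [1 - x + x^2 / 2] on [expR (- x)] is at most
   [1 - x / 2]. *)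
have Am : N * (expR (- x) * cos y - 1) <= - v / 2.
  rewrite vE (_ : - (N * x) / 2 = N * (- x / 2)); last by ring.
  rewrite ler_pM2l//.
  have : expR (- x) * cos y <= expR (- x) by rewrite ger_pMr ?expR_gt0// cos_le1.
  have : 0 <= x * (1 - x) by rewrite mulr_ge0 ?subr_ge0.
  by have := expRN_le x0; move: (expR (- x)) (cos y) => *; lra.
have Bm : - v <= - v / 2 by lra.
apply: le_trans (norm_expR_sinB_le _ _ _ Am Bm) _.
rewrite ler_pM2r ?expR_gt0// vwE vE.
(* The real and imaginary remainders add up to [x^2 + 3 y^2 / 2]; the last summand is the slack left
   by the rounder constant [2]. *)
have -> : 2 * (N * x) ^+ 2 * (1 + w ^+ 2) / N =
          N * ((x ^+ 2 + y ^+ 2) / 2 + (y ^+ 2 + x ^+ 2 / 2)) + N * (x ^+ 2 + y ^+ 2 / 2).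
  by rewrite /y; field; rewrite gt_eqF.
apply: ler_wpDr.
  by rewrite mulr_ge0 ?(ltW N0)// addr_ge0// ?divr_ge0 ?sqr_ge0.
rewrite [leRHS]mulrDr lerD//.
  rewrite opprK -mulrDr normrM gtr0_norm// ler_pM2l//.
  exact: norm_expR_cos_le.
by rewrite -mulrBr normrM gtr0_norm// ler_pM2l// norm_expR_sin_le.
Qed.

End elementary_bounds.

(* The majorant [g] may blow up at [0], hence the crude bound [L] near [0]. *)
Lemma norm_Rintegral_le_derive (R : realType) (k G g : R -> R) (T B L : R) :
  0 < T -> measurable_fun setT k -> (forall t, 0 < t <= T -> `|k t| <= L) ->
  (forall t, 0 < t <= T -> is_derive t 1 G (g t)) ->
  (forall t, 0 < t <= T -> derivable g t 1) ->
  (forall t, 0 < t <= T -> `|k t| <= g t) ->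
  (forall e, 0 < e <= T -> G T - G e <= B) ->
  `|\int[lebesgue_measure]_(t in `]0, T]) k t| <= B.
Proof.
move=> T0 mk kL G' g' kg GB.
have L0 : 0 <= L by apply: le_trans (kL T _); rewrite ?T0 ?lexx.
have ik : lebesgue_measure.-integrable `]0, T] (EFin \o k).
  apply: (@bounded_integrable _ _ _ _ _ _ L) => //.
  - exact: lebesgue_segment_ltoo.
  - exact: measurable_funTS.
(* On []0, r]] the crude bound contributes at most [L r <= e]; [L + 1] keeps the quotient meaningful
   when [L = 0]. *)
apply/ler_addgt0Pr => e e0; pose r := Num.min T (e / (L + 1)).
have L1 : 0 < L + 1 by rewrite ltr_wpDl.
have r0 : 0 < r by rewrite lt_min T0 divr_gt0.
have rT : r <= T by rewrite ge_min lexx.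
have rL : L * r <= e.
  have : r <= e / (L + 1) by rewrite ge_min lexx orbT.
  move=> /(ler_wpM2l L0)/le_trans; apply.
  by rewrite mulrA ler_pdivrMr// mulrC ler_wpM2l ?(ltW e0)// lerDl.
have U : `]0, T]%classic = `]0, r] `|` `]r, T].
  by rewrite -itv_bndbnd_setU// bnd_simp// ltW.
rewrite U Rintegral_setU//; last 2 first.
- by rewrite -U.
- by apply/disj_setPS => t [/=]; rewrite !in_itv /= => /andP[_ tr] /andP[]; rewrite ltNge tr.
rewrite (le_trans (ler_normD _ _))// addrC lerD//.
  have ik2 : lebesgue_measure.-integrable `]r, T] (EFin \o k).
    by apply: integrableS ik => //; rewrite U; right.
  apply: le_trans (le_normr_Rintegral _ _) _ => //.
  have ig : lebesgue_measure.-integrable `[r, T] (EFin \o g).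
    by apply: derivable_integrable => t /andP[rt tT]; apply: g'; rewrite tT (lt_le_trans r0).
  have ig2 : lebesgue_measure.-integrable `]r, T] (EFin \o g).
    by apply: integrableS ig => //; exact: subset_itv_oc_cc.
  apply: (@le_trans _ _ (\int[lebesgue_measure]_(t in `]r, T]) g t)).
    apply: le_Rintegral => //; first exact: integrable_norm.
    by move=> t /=; rewrite in_itv /= => /andP[rt tT]; rewrite kg// tT (lt_trans r0).
  have rt0 (t : R) : r <= t <= T -> 0 < t <= T.
    by move=> /andP[rt ->]; rewrite (lt_le_trans r0).
  rewrite Rintegral_itv_obnd_cbnd//.
  have -> : \int[lebesgue_measure]_(t in `[r, T]) g t = G T - G r.
    by apply: Rintegral_derive => // t /rt0; [exact: G'|exact: g'].
  by rewrite GB// r0.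
apply: le_trans rL.
have ik1 : lebesgue_measure.-integrable `]0, r] (EFin \o k).
  by apply: integrableS ik => //; rewrite U; left.
apply: le_trans (le_normr_Rintegral _ _) _ => //.
apply: (@le_trans _ _ (\int[lebesgue_measure]_(t in `]0, r]) L)).
  apply: le_Rintegral => //.
  - exact: integrable_norm.
  - apply: (@bounded_integrable _ _ _ _ _ _ `|L|) => //.
    exact: lebesgue_segment_ltoo.
  - by move=> t /=; rewrite in_itv /= => /andP[t0 tr]; rewrite kL// t0 (le_trans tr).
by rewrite Rintegral_cst//= lebesgue_measure_itv /= lte_fin r0 oppr0 addr0.
Qed.

(** Adding [L] makes the kernel nonnegative, so the measurability part of Tonelli applies; since
    [mu] has mass [1], the shift is then subtracted exactly. *)
Lemma measurable_Rintegral d1 d2 (T1 : measurableType d1) (T2 : measurableType d2)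
    (R : realType) (mu : probability T1 R) (k : T1 * T2 -> R) (L : R) :
  measurable_fun setT k -> (forall z, `|k z| <= L) ->
  measurable_fun setT (fun y => \int[mu]_x k (x, y)).
Proof.
move=> mk kL; pose f (z : T1 * T2) : \bar R := (k z + L)%:E.
have mf : measurable_fun setT f by apply/measurable_EFinP; exact: measurable_funD.
have f0 z : (0 <= f z)%E.
  by rewrite lee_fin -lerBlDr sub0r; have := kL z; rewrite ler_norml => /andP[].
have mF := measurable_fun_fubini_tonelli_G (m1 := mu) f mf f0.
rewrite (_ : (fun y => _) = (fun y => fine (\int[mu]_x f (x, y))%E - L)).
  by apply: measurable_funB => //; exact: measurableT_comp.
apply/funext => y; rewrite /f -/(Rintegral mu setT (fun x => k (x, y) + L)).
have i1 : mu.-integrable setT (EFin \o (fun=> L)).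
  by apply: (@integrable_prob _ _ _ _ _ `|L|).
have i2 : mu.-integrable setT (EFin \o (fun x => k (x, y))).
  apply: (@integrable_prob _ _ _ _ _ L) => //.
  exact: measurableT_comp mk _.
rewrite RintegralD// Rintegral_cst//.
by rewrite fine_probability_setT mulr1 addrK.
Qed.

(** * From Fourier transforms to smoothed distribution functions and concentration *)

Section fejer_cdfB.
Context {R : realType}.
Variables (mu1 mu2 : probability R R) (T : R).
Hypothesis T0 : 0 < T.
Implicit Types mu : probability R R.

Let measurable_sin_shift (c : R) :
  measurable_fun setT (fun z : R * R => sin ((c - z.1) * z.2)).
Proof.
by apply: measurable_fun_sin; apply: measurable_funM => //; exact: measurable_funB.
Qed.

Let integrable_sin_shift mu (c t : R) :
  mu.-integrable setT (EFin \o (fun u => sin ((c - u) * t))).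
Proof.
apply: (@integrable_prob _ _ _ _ _ 1); last by move=> x; exact: sin_max.
by apply: measurable_fun_sin; apply: measurable_funM => //; exact: measurable_funB.
Qed.

Let measurable_integral_sin_shift mu (c : R) :
  measurable_fun setT (fun t => \int[mu]_u sin ((c - u) * t)).
Proof.
apply: (@measurable_Rintegral _ _ _ _ _ mu (fun z => sin ((c - z.1) * z.2)) 1) => //.
by move=> z; exact: sin_max.
Qed.

Let integral_sin_shift_le mu (a b t : R) : a <= b -> 0 < t ->
  `|\int[mu]_u sin ((b - u) * t) - \int[mu]_u sin ((a - u) * t)| <= (b - a) * t.
Proof.
move=> ab t0; have ia := integrable_sin_shift mu a t.
have ib := integrable_sin_shift mu b t; rewrite -RintegralB//.
have iB : mu.-integrable setT
    (EFin \o (fun u => sin ((b - u) * t) - sin ((a - u) * t))).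
  exact: (integrableB measurableT ib ia).
have icst : mu.-integrable setT (EFin \o (fun=> (b - a) * t)).
  by apply: (@integrable_prob _ _ _ _ _ `|(b - a) * t|).
apply: le_trans (le_normr_Rintegral _ _) _ => //.
apply: (@le_trans _ _ (\int[mu]_u ((b - a) * t))).
  apply: le_Rintegral => //; first exact: integrable_norm.
  move=> u _; apply: le_trans (sin_lipschitz _ _) _.
  rewrite -mulrBl normrM (gtr0_norm t0) opprD addrACA subrr addr0 ger0_norm//.
  by rewrite subr_ge0.
rewrite Rintegral_cst//.
by rewrite fine_probability_setT mulr1.
Qed.

(** The factor [2] in the hypothesis on sines pays for its use at both [s = a] and [s = b]. The
    length [b - a] only secures integrability and does not reach [B]. *)
Lemma fejer_cdfB_le (G g : R -> R) (a b B : R) : a <= b ->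
  (forall t, 0 < t <= T -> is_derive t 1 G (g t)) ->
  (forall t, 0 < t <= T -> derivable g t 1) ->
  (forall s t, 0 < t <= T ->
    2 * `|\int[mu1]_u sin ((s - u) * t) - \int[mu2]_u sin ((s - u) * t)| <= t * g t) ->
  (forall e, 0 < e <= T -> G T - G e <= B) ->
  `|\int[lebesgue_measure]_x (fejer T x *
      ((cdfR mu1 (b - x) - cdfR mu2 (b - x)) -
       (cdfR mu1 (a - x) - cdfR mu2 (a - x))))| <= B.
Proof.
move=> ab G' g' kg GB.
pose k mu t : R := (1 - t / T) * t `^ (-1) *
  (\int[mu]_u sin ((b - u) * t) - \int[mu]_u sin ((a - u) * t)).
have mk mu : measurable_fun setT (k mu).
  apply: measurable_funM; last by apply: measurable_funB.
  apply: measurable_funM; last exact: measurable_powR.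
  by apply: measurable_funB => //; exact: measurable_funM.
have kE mu t : 0 < t -> k mu t = (1 - t / T) / t *
    (\int[mu]_u sin ((b - u) * t) - \int[mu]_u sin ((a - u) * t)).
  by move=> t0; rewrite /k powR_inv1// ltW.
have kL mu t : 0 < t <= T -> `|k mu t| <= b - a.
  move=> /andP[t0 tT]; rewrite kE// normrM.
  have /andP[w0 w1] : 0 <= 1 - t / T <= 1 by apply: weight_ge0; rewrite ?tT ?ltW.
  have ba0 : 0 <= b - a by rewrite subr_ge0.
  have := integral_sin_shift_le mu ab t0.
  rewrite normrM normfV (gtr0_norm t0) (ger0_norm w0) => H.
  rewrite -mulrA; apply: (@le_trans _ _ (1 * (t^-1 * ((b - a) * t)))).
    apply: ler_pM => //; first by rewrite mulr_ge0// invr_ge0 ltW.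
    by rewrite ler_pM2l ?invr_gt0.
  by rewrite mul1r mulrCA mulVf ?mulr1// gt_eqF.
have ik mu : lebesgue_measure.-integrable `]0, T] (EFin \o k mu).
  apply: (@bounded_integrable _ _ _ _ _ _ (b - a)) => //.
  - exact: lebesgue_segment_ltoo.
  - exact: measurable_funTS (mk mu).
  - by move=> t /=; rewrite in_itv /=; exact: kL.
have cdfk mu : \int[lebesgue_measure]_x (fejer T x * (cdfR mu (b - x) - cdfR mu (a - x))) =
    \int[lebesgue_measure]_(t in `]0, T]) k mu t.
  rewrite integral_fejer_cdf// integral_prob_fejer_itv//.
  by apply: eq_Rintegral => t; rewrite inE /= in_itv /= => /andP[t0 _]; rewrite kE.
have icdf mu : lebesgue_measure.-integrable setT
    (EFin \o (fun x => fejer T x * (cdfR mu (b - x) - cdfR mu (a - x)))).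
  have mB (c : R) : measurable_fun [set: R] (fun x : R => cdfR mu (c - x)).
    apply: (measurableT_comp (measurable_cdfR mu)).
    exact: measurable_funB.
  apply: (@integrable_fejerM _ _ T0 _ 1); first exact: measurable_funB.
  move=> x; have := cdfR_ge0 mu (b - x); have := cdfR_ge0 mu (a - x).
  have := cdfR_le1 mu (b - x); have := cdfR_le1 mu (a - x).
  rewrite ler_norml; move: (cdfR mu (b - x)) (cdfR mu (a - x)) => *; lra.
have -> : \int[lebesgue_measure]_x (fejer T x *
      ((cdfR mu1 (b - x) - cdfR mu2 (b - x)) -
       (cdfR mu1 (a - x) - cdfR mu2 (a - x)))) =
    \int[lebesgue_measure]_(t in `]0, T]) (k mu1 t - k mu2 t).
  rewrite RintegralB// -!cdfk -RintegralB//.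
  by apply: eq_Rintegral => x _; ring.
apply: (@norm_Rintegral_le_derive _ _ G g _ _ ((b - a) + (b - a))) => //.
- exact: measurable_funB.
- by move=> t tT; rewrite (le_trans (ler_normB _ _))// lerD// kL.
- move=> t tT; have /andP[t0 tT'] := tT; rewrite !kE// -mulrBr normrM.
  have /andP[w0 w1] : 0 <= 1 - t / T <= 1 by apply: weight_ge0; rewrite ?tT' ?ltW.
  rewrite normrM normfV (gtr0_norm t0) (ger0_norm w0).
  apply: (@le_trans _ _ (t^-1 * (t * g t))); last by rewrite mulKf// gt_eqF.
  apply: ler_pM => //; first by rewrite mulr_ge0// invr_ge0 ltW.
    by rewrite ler_piMl// invr_ge0 ltW.
  have := kg a t tT; have := kg b t tT.
  move: (\int[mu1]_u _) (\int[mu1]_u _) (\int[mu2]_u _) (\int[mu2]_u _) => x1 x2 x3 x4 H1 H2.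
  have -> : x2 - x1 - (x4 - x3) = (x2 - x4) - (x1 - x3) by ring.
  apply: le_trans (ler_normB _ _) _; move: `|x1 - x3| `|x2 - x4| H1 H2 => *; lra.
Qed.

End fejer_cdfB.

(** By [fejer_ge] the mass of the interval is at most [4 / T] times the average of the kernel
    centred at [s], and that average is an integral of the characteristic function over [[0, T]]. *)
Lemma concentration (R : realType) (mu : probability R R) (T s B : R) (G g : R -> R) :
  0 < T ->
  (forall t, 0 <= t <= T -> is_derive t 1 G (g t)) ->
  (forall t, 0 <= t <= T -> derivable g t 1) ->
  (forall t, 0 <= t <= T -> `|\int[mu]_x cos ((x - s) * t)| <= g t) ->
  G T - G 0 <= B ->
  fine (mu `[s - T^-1, s + T^-1]%classic) <= 4 / T * B.
Proof.
move=> T0 G' g' cosg GB; pose I := `[s - T^-1, s + T^-1]%classic.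
pose k (z : R * R) : R := cos ((z.1 - s) * z.2).
have mk : measurable_fun setT k.
  by apply: measurable_fun_cos; apply: measurable_funM => //; exact: measurable_funB.
have mcos : measurable_fun setT (fun t => \int[mu]_x k (x, t)).
  by apply: (@measurable_Rintegral _ _ _ _ _ mu k 1) => // z; exact: cos_max.
have ig : lebesgue_measure.-integrable `[0, T] (EFin \o g) by exact: derivable_integrable.
have cos1 t : `|\int[mu]_x k (x, t)| <= 1.
  have it : mu.-integrable setT (EFin \o (fun x => k (x, t))).
    apply: (@integrable_prob _ _ _ _ _ 1); last by move=> x; exact: cos_max.
    exact: measurableT_comp mk _.
  have i1 : mu.-integrable setT (EFin \o (fun=> 1 : R)).
    by apply: (@integrable_prob _ _ _ _ _ 1) => // x; rewrite normr1.
  apply: le_trans (le_normr_Rintegral _ it) _ => //.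
  apply: (@le_trans _ _ (\int[mu]_x 1)).
    apply: le_Rintegral => //; first exact: integrable_norm.
    by move=> x _; exact: cos_max.
  rewrite Rintegral_cst//.
  by rewrite fine_probability_setT mulr1.
have fejerB : \int[mu]_x fejer T (x - s) <= B.
  rewrite integral_fejer_prob//.
  apply: (@le_trans _ _ (\int[lebesgue_measure]_(t in `[0, T]) g t)).
    apply: le_Rintegral => //.
      apply: (@bounded_integrable _ _ _ _ _ _ 1) => //.
      - exact: lebesgue_segment_ltoo.
      - apply: measurable_funTS; apply: measurable_funM => //.
        by apply: measurable_funB => //; exact: measurable_funM.
      - move=> t /=; rewrite in_itv /= => tT; rewrite normrM.
        have /andP[w0 w1] := weight_ge0 T0 tT.
        rewrite (ger0_norm w0); exact: le_trans (ler_piMl (normr_ge0 _) w1) (cos1 t).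
    move=> t /=; rewrite in_itv /= => tT.
    have /andP[w0 w1] := weight_ge0 T0 tT.
    apply: le_trans (ler_norm _) _; rewrite normrM (ger0_norm w0) -[leRHS]mul1r.
    by rewrite ler_pM// cosg.
  by rewrite (Rintegral_derive (ltW T0) G').
have mI : measurable I by exact: measurable_itv.
have fI x : T / 4 * \1_I x <= fejer T (x - s).
  rewrite indicE; have [|_] := boolP (x \in I); last by rewrite mulr0 fejer_ge0.
  rewrite mulr1 inE /I /= in_itv /= => /andP[x1 x2]; apply: fejer_ge => //.
  by rewrite ler_norml; apply/andP; split; lra.
have iI : mu.-integrable setT (EFin \o \1_I).
  apply: (@integrable_prob _ _ _ _ _ 1) => // x; rewrite indicE.
  by case: (x \in I); rewrite ?normr1 ?normr0.
have : \int[mu]_x (T / 4 * \1_I x) <= \int[mu]_x fejer T (x - s).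
  apply: le_Rintegral => //.
  - exact: (@integrableZl _ _ _ mu setT measurableT (T / 4) _ iI).
  - apply: (@integrable_prob _ _ _ _ _ T).
      by apply: (measurableT_comp (measurable_fejer T0)); exact: measurable_funB.
    by move=> x; rewrite ger0_norm ?fejer_ge0// fejer_le_T.
rewrite RintegralZl// => /le_trans/(_ fejerB).
have -> : \int[mu]_x \1_I x = fine (mu I).
  by rewrite /Rintegral integral_indic// setIT.
move: (fine _) => p pB; have : 4 / T * (T / 4 * p) <= 4 / T * B.
  by rewrite ler_wpM2l// divr_ge0 ?(ltW T0).
suff -> : 4 / T * (T / 4 * p) = p by [].
by field; rewrite gt_eqF.
Qed.

(** * Explicit majorants and their primitives *)

(** With [m = Num.bound (2 / alpha)] and [v = u^alpha], one has [u^2 <= v^m <= m! * expR v] for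
    [u > 1], because [alpha * m >= 2]. The factor [4] comes from [(1 + u)^2 <= 4 * max(1, u)^2]. *)
Definition stable_const (R : realType) (alpha : R) : R :=
  4 * (Num.bound (2 / alpha))`!%:R.

Lemma stable_const_ge (R : realType) (alpha u : R) : 0 < alpha -> 0 <= u ->
  expR (- u `^ alpha) <= stable_const alpha / (1 + u) ^+ 2.
Proof.
move=> a0 u0; have u1 : 0 < (1 + u) ^+ 2 by rewrite exprn_gt0// ltr_pwDl.
rewrite ler_pdivlMr//.
set v := u `^ alpha; have v0 : 0 <= v by exact: powR_ge0.
have ev : expR (- v) <= 1 by rewrite -expR0 ler_expR oppr_le0.
have a2 : 0 <= 2 / alpha by rewrite divr_ge0// ltW.
rewrite /stable_const; have := archi_boundP a2.
case: (Num.bound (2 / alpha)) => [|k]; first by rewrite ltNge a2.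
rewrite ltr_pdivrMr// => /ltW ka.
have fk : (1 : R) <= k.+1`!%:R by rewrite ler1n fact_gt0.
have [u_le1|u_gt1] := leP u 1.
  have u2 : (1 + u) ^+ 2 <= 4.
    have : 0 <= (1 - u) * (3 + u) by apply: mulr_ge0; lra.
    by move=> ?; lra.
  rewrite (le_trans (ler_pM _ _ ev u2))// ?expR_ge0 ?(ltW u1)// mul1r.
  by rewrite ler_peMr.
have vk : u ^+ 2 <= v ^+ k.+1.
  rewrite -!powR_mulrn// /v -powRrM mulrC ler_powR// ltW//.
have := expR_ge1Dxn k v0 => H.
have {}H : v ^+ k.+1 <= k.+1`!%:R * expR v.
  rewrite mulrC -ler_pdivrMr ?ltr0n ?fact_gt0//.
  by apply: le_trans H; rewrite lerDr.
have u24 : (1 + u) ^+ 2 <= 4 * u ^+ 2.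
  have : 0 <= (u - 1) * (3 * u + 1) by apply: mulr_ge0; lra.
  by move=> ?; lra.
rewrite expRN mulrC ler_pdivrMr ?expR_gt0//.
apply: le_trans u24 _; rewrite -mulrA ler_wpM2l//.
exact: le_trans H.
Qed.

Section stable_derivatives.
Context {R : realType}.
Variables c alpha : R.
Hypothesis c0 : 0 < c.

Lemma is_derive_powRM (t : R) : 0 < t ->
  is_derive t 1 (fun s : R => (c * s) `^ alpha) (alpha * (c * t) `^ alpha / t).
Proof.
move=> t0; have ct0 : 0 < c * t by rewrite mulr_gt0.
have h' : is_derive t 1 (fun s : R => c * s) c.
  by apply: is_derive_eq; rewrite /GRing.scale /=; ring.
have := @is_derive1_comp _ (@powR R ^~ alpha) (fun s => c * s) t _ _ (is_derive1_powR alpha ct0) h'.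
suff -> : alpha * (c * t) `^ (alpha - 1) * c = alpha * (c * t) `^ alpha / t by [].
rewrite powRB ?(gt_eqF ct0) ?implybT// powRr1 ?(ltW ct0)//; field.
by rewrite !gt_eqF.
Qed.

(* Since [v = (c t)^alpha] satisfies [v' = alpha v / t], the bound
   [v^2 e^(-v/2) / t] has an elementary primitive. *)
Definition exp_bound (M t : R) : R :=
  M * alpha * ((c * t) `^ alpha) ^+ 2 / t * expR (- (c * t) `^ alpha / 2).

Definition exp_primitive (M t : R) : R :=
  - M * (2 * (c * t) `^ alpha + 4) * expR (- (c * t) `^ alpha / 2).

(** A majorant bounded at [0], with integral at most [K / c]. It serves for the concentration of [Y]
    and, when [alpha = 1], also for the logarithmic estimate. *)
Definition inv_bound (K t : R) : R := K / (1 + c * t) ^+ 2.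

Definition inv_primitive (K t : R) : R := - (K / c) * (1 + c * t)^-1.

Lemma exp_primitive_derive (M t : R) : 0 < t ->
  is_derive t 1 (exp_primitive M) (exp_bound M t) /\ derivable (exp_bound M) t 1.
Proof.
move=> t0; rewrite /exp_primitive /exp_bound; have V' := is_derive_powRM t0.
have tn0 : t != 0 by rewrite gt_eqF.
have I' : is_derive t 1 (fun y : R => y^-1) (- t ^- 2).
  by have := @is_deriveV _ id t 1 1 tn0 (is_derive_id _ _); rewrite scaler1.
split; last exact: ex_derive.
by apply: is_derive_eq; rewrite /GRing.scale /=; field.
Qed.

(** The primitive is nonpositive, and it is at least [- 4 M] because [1 + v / 2 <= expR (v / 2)]. *)
Lemma exp_primitive_le (M e T : R) : 0 <= M ->
  exp_primitive M T - exp_primitive M e <= 4 * M.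
Proof.
move=> M0; have GT : exp_primitive M T <= 0.
  rewrite /exp_primitive !mulNr oppr_le0 mulr_ge0 ?expR_ge0// mulr_ge0// addr_ge0//.
  by rewrite mulr_ge0// powR_ge0.
suff : - (4 * M) <= exp_primitive M e by lra.
rewrite /exp_primitive; move: ((c * e) `^ alpha) => v.
have : (v / 2 + 1) * expR (- v / 2) <= 1.
  rewrite mulNr expRN ler_pdivrMr ?expR_gt0// mul1r addrC; exact: expR_ge1Dx.
by move=> /(ler_wpM2l M0); move: (expR _) => E; lra.
Qed.

Lemma inv_primitive_derive (K t : R) : 0 <= t ->
  is_derive t 1 (inv_primitive K) (inv_bound K t) /\ derivable (inv_bound K) t 1.
Proof.
move=> t0; rewrite /inv_primitive /inv_bound; have h0 : 1 + c * t != 0.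
  by rewrite gt_eqF// ltr_pwDl// mulr_ge0// ltW.
have h20 : (1 + c * t) ^+ 2 != 0 by rewrite expf_neq0.
have cn0 : c != 0 by rewrite gt_eqF.
have h' : is_derive t 1 (fun s : R => 1 + c * s) c.
  by apply: is_derive_eq; rewrite /GRing.scale /=; ring.
have h2' : is_derive t 1 (fun s : R => (1 + c * s) ^+ 2) (2 * c * (1 + c * t)).
  by apply: is_derive_eq; rewrite /GRing.scale /=; ring.
have I1 : is_derive t 1 (fun s : R => (1 + c * s)^-1) (- (1 + c * t) ^- 2 *: c).
  exact: (@is_deriveV _ (fun s => 1 + c * s)).
have I2 : is_derive t 1 (fun s : R => ((1 + c * s) ^+ 2)^-1)
    (- ((1 + c * t) ^+ 2) ^- 2 *: (2 * c * (1 + c * t))).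
  exact: (@is_deriveV _ (fun s => (1 + c * s) ^+ 2)).
split; last exact: ex_derive.
by apply: is_derive_eq; rewrite /GRing.scale /=; field; rewrite h0.
Qed.

Lemma inv_primitive_le (K e T : R) : 0 <= K -> 0 <= e -> 0 <= T ->
  inv_primitive K T - inv_primitive K e <= K / c.
Proof.
move=> K0 e0 T0; have Kc : 0 <= K / c by rewrite divr_ge0// ltW.
have d0 (t : R) : 0 <= t -> 0 <= (1 + c * t)^-1 <= 1.
  move=> t0; have ct : 0 <= c * t by rewrite mulr_ge0// ltW.
  by rewrite invr_ge0 invf_le1 ?lerDl ?addr_ge0// ltr_pwDl.
have /andP[T1 _] := d0 _ T0; have /andP[_ e1] := d0 _ e0.
rewrite /inv_primitive mulNr; have := mulr_ge0 Kc T1; have := ler_wpM2l Kc e1.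
by move: (_^-1) (_^-1) => *; lra.
Qed.

End stable_derivatives.

(** For [s = sqrt u] the bounds [- 1 / s <= ln s <= s] give [|s ln s| <= 1 + s^2], and the left-hand
    side is [4 (s ln s)^2]. *)
Lemma ln_sqr_le (R : realType) (u : R) : 0 < u -> u * ln u ^+ 2 <= 4 * (1 + u) ^+ 2.
Proof.
move=> u0; set s := Num.sqrt u; have s0 : 0 < s by rewrite sqrtr_gt0.
have us : u = s ^+ 2 by rewrite sqr_sqrtr// ltW.
have lnu : ln u = ln s *+ 2 by rewrite us lnXn.
have ln1 : ln s <= s by rewrite ltW// ln_sublinear.
have ln2 : - ln s <= s^-1 by rewrite -lnV// ltW// ln_sublinear// invr_gt0.
have ss : s * s^-1 = 1 by rewrite divff// gt_eqF.
have ln3 : (s * ln s) ^+ 2 <= (1 + s ^+ 2) ^+ 2.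
  rewrite -(real_normK (num_real (s * ln s))) ler_sqr ?nnegrE ?addr_ge0 ?sqr_ge0//.
  rewrite ler_norml; apply/andP; split.
    have := ler_wpM2l (ltW s0) ln2; have := sqr_ge0 s; rewrite ss => *; lra.
  have := ler_wpM2l (ltW s0) ln1 => *; lra.
rewrite lnu {1 2}us.
have -> : s ^+ 2 * (ln s *+ 2) ^+ 2 = 4 * (s * ln s) ^+ 2 by ring.
by rewrite ler_pM2l.
Qed.

(* [768 = 2 * 2^4 * 4!], from [expR (1 / 2) <= 2] and [x^4 / 4! <= expR x] at
   [x = (1 + u) / 2]. *)
Lemma expR_half_le (R : realType) (u : R) : 0 <= u ->
  (1 + u) ^+ 2 * expR (- u / 2) <= 768 / (1 + u) ^+ 2.
Proof.
move=> u0; have u1 : 0 < 1 + u by rewrite ltr_pwDl.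
rewrite ler_pdivlMr ?exprn_gt0//.
have h0 : 0 <= (1 + u) / 2 by rewrite divr_ge0// ltW.
have H1 : ((1 + u) / 2) ^+ 4 <= 24 * expR ((1 + u) / 2).
  have := expR_ge1Dxn 3 h0; rewrite (_ : 4`! = 24%N)// => *; lra.
have e2 : expR (2^-1 : R) <= 2.
  have : expR (- 2^-1 : R) >= 1 - 2^-1 by exact: expR_ge1Dx.
  rewrite expRN => H; have := expR_gt0 (2^-1 : R) => e0.
  have := ler_wpM2l (ltW e0) H; rewrite divff ?gt_eqF// => *; lra.
rewrite mulrDl mul1r expRD in H1.
have e0 : 0 < expR (u / 2) := expR_gt0 _.
have -> : (1 + u) ^+ 2 * expR (- u / 2) * (1 + u) ^+ 2 = (1 + u) ^+ 4 / expR (u / 2).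
  by rewrite mulNr expRN; ring.
rewrite ler_pdivrMr//.
have -> : (1 + u) ^+ 4 = 16 * (2^-1 + u / 2) ^+ 4 by field.
have := ler_wpM2r (ltW e0) e2.
move=> H2; apply: (@le_trans _ _ (16 * (24 * (expR 2^-1 * expR (u / 2))))).
  by rewrite ler_pM2l.
lra.
Qed.

Lemma stable_fourier (R : realType) (c alpha beta : R) (mu : probability R R) (t : R) :
  0 < c -> 0 <= t -> stable_law c alpha beta mu ->
  let v := (c * t) `^ alpha in let b := v * (beta * stable_h alpha t * Num.sg t) in
  \int[mu]_x cos (x * t) = expR (- v) * cos b /\
  \int[mu]_x sin (x * t) = expR (- v) * sin b.
Proof.
move=> c0 t0 /(_ t) /fourier_expC; have [-> ->] := stable_exponentE c alpha beta t.
by rewrite ger0_norm// mulr_ge0// ltW.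
Qed.

Lemma stable_cos_le (R : realType) (c alpha beta : R) (mu : probability R R) (s t : R) :
  0 < c -> 0 < alpha -> 0 <= t -> stable_law c alpha beta mu ->
  `|\int[mu]_x cos ((x - s) * t)| <= inv_bound c (stable_const alpha) t.
Proof.
move=> c0 a0 t0 /(stable_fourier c0 t0)[Ecos Esin].
rewrite (integral_cos_shift Ecos Esin) normrM gtr0_norm ?expR_gt0//.
have ct0 : 0 <= c * t by rewrite mulr_ge0// ltW.
apply: le_trans (stable_const_ge a0 ct0).
by rewrite ler_piMr ?expR_ge0// cos_max.
Qed.

(** The exponent of [phi] is exactly that of [mu] divided by [N]: rescaling [c] divides
    [|c t|^alpha] by [N], while [stable_h] depends on [t] alone. This remains true for the logarithm
    at [alpha = 1]. *)
Lemma stable_compound_sinB (R : realType) (c alpha beta N : R)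
    (mu phi nu : probability R R) (s t : R) :
  0 < c -> 0 < alpha -> 0 < N -> 0 < t -> (c * t) `^ alpha <= N ->
  stable_law c alpha beta mu ->
  stable_law (c / N `^ alpha^-1) alpha beta phi ->
  compound_Poisson N phi nu ->
  `|\int[nu]_u sin ((s - u) * t) - \int[mu]_u sin ((s - u) * t)| <=
  2 * ((c * t) `^ alpha) ^+ 2 * (1 + (beta * stable_h alpha t) ^+ 2) / N *
    expR (- (c * t) `^ alpha / 2).
Proof.
move=> c0 a0 N0 t0 vN mustable phistable nuP; have ct0 : 0 < c * t by rewrite mulr_gt0.
have [Ecos Esin] := stable_fourier c0 (ltW t0) mustable.
have Na0 : 0 < N `^ alpha^-1 by exact: powR_gt0.
have cN0 : 0 < c / N `^ alpha^-1 by rewrite divr_gt0.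
have [phicos phisin] := stable_fourier cN0 (ltW t0) phistable.
have [nucos nusin] := fourier_expC (compound_PoissonE t nuP).
rewrite (integral_sin_shift nucos nusin) (integral_sin_shift Ecos Esin) /=.
rewrite phicos phisin gtr0_sg// mulr1.
have -> : (c / N `^ alpha^-1 * t) `^ alpha = (c * t) `^ alpha / N.
  have Ni0 : 0 <= (N `^ alpha^-1)^-1 by rewrite invr_ge0 ltW.
  rewrite mulrAC (powRM _ (ltW ct0) Ni0); congr (_ * _).
  rewrite -powR_inv1 ?powR_ge0// -!powRrM.
  rewrite mulN1r mulrN mulVf ?gt_eqF//.
  by rewrite powR_inv1// ltW.
by apply: compound_exponent_diff => //; exact: powR_ge0.
Qed.

(** The first summand is the concentration term of [dKol_stable_le]. In the second,
    [144 = 4 * 4 * 9]: Esseen's factor, the [4] from doubling [stable_compound_sinB], and the [9] of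
    the logarithmic estimate; [768] is from [expR_half_le]. *)
Definition log_const (R : realType) : R := 256 * stable_const 1 + 144 * 768.

Lemma log_const_ge0 (R : realType) : 0 <= log_const R.
Proof.
have S0 : 0 <= stable_const 1 :> R by rewrite /stable_const mulr_ge0.
exact: addr_ge0 (mulr_ge0 (ler0n R 256) S0) (mulr_ge0 (ler0n R 144) (ler0n R 768)).
Qed.

(** * Kolmogorov bounds for stable laws *)

Section dKol.
Context {R : realType}.
Variables (d1 d2 : measure_display) (T1 : measurableType d1) (T2 : measurableType d2).
Variables (P1 : probability T1 R) (P2 : probability T2 R).
Variables (X1 : {RV P1 >-> R}) (X2 : {RV P2 >-> R}).
Local Notation mu1 := (distribution P1 X1).
Local Notation mu2 := (distribution P2 X2).

Lemma dKol_le (B : R) : (forall x, `|cdfR mu1 x - cdfR mu2 x| <= B) ->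
  (dKol X1 X2 <= B%:E)%E.
Proof.
move=> HB; apply: ge_ereal_sup => _ [x _ <-].
have fin d (T : measurableType d) (P : probability T R) (X : {RV P >-> R}) :
    cdf X x = (cdfR (distribution P X) x)%:E.
  by rewrite /cdfR /cdf fineK//; exact: probability_fin_num.
by rewrite !fin -EFinB abse_EFin lee_fin.
Qed.

(** Esseen's windows have length [64 / T], so [concentration] is applied at frequency [T / 32]. It
    gives [kappa = 128 * stable_const alpha / (T * c)], which Esseen's inequality doubles. *)
Lemma dKol_stable_le (c alpha beta T B : R) (G g : R -> R) :
  0 < c -> 0 < alpha -> 0 < T -> stable_law c alpha beta mu2 ->
  (forall t, 0 < t <= T -> is_derive t 1 G (g t)) ->
  (forall t, 0 < t <= T -> derivable g t 1) ->
  (forall s t, 0 < t <= T ->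
    2 * `|\int[mu1]_u sin ((s - u) * t) - \int[mu2]_u sin ((s - u) * t)| <= t * g t) ->
  (forall e, 0 < e <= T -> G T - G e <= B) ->
  (dKol X1 X2 <= (256 * stable_const alpha / (T * c) + 4 * B)%:E)%E.
Proof.
move=> c0 a0 T0 stab G' g' kg GB; apply: dKol_le => x.
have K0 : 0 <= stable_const alpha by rewrite /stable_const mulr_ge0.
have -> : 256 * stable_const alpha / (T * c) + 4 * B =
    2 * (4 / (T / 32) * (stable_const alpha / c)) + 4 * B.
  by field; rewrite !gt_eqF.
have B0 : 0 <= B by have := GB T; rewrite subrr; apply; rewrite T0 lexx.
apply: (@esseen_inequality _ _ _ _ _ _ _ _ _ T) => //; last first.
  by move=> a b ab; exact: (fejer_cdfB_le T0 ab G' g' kg GB).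
move=> y; have T32 : 0 < T / 32 by rewrite divr_gt0.
rewrite cdfRB; last by rewrite lerDl mulr_ge0// divr_ge0// ltW.
pose J := `[(y + 32 / T) - (T / 32)^-1, (y + 32 / T) + (T / 32)^-1]%classic.
have mJ : measurable J by exact: measurable_itv.
have sub : `]y, y + 2 * (32 / T)] `<=` J.
  move=> z; rewrite /J /= !in_itv /= invf_div => /andP[z1 z2].
  by apply/andP; split; move: (32 / T) z2 => w z2; lra.
apply: (@le_trans _ _ (fine (mu2 J))).
  apply: fine_le; rewrite ?probability_fin_num//.
  by apply: le_measure; rewrite ?inE.
set K := stable_const alpha in K0 *.
apply: (@concentration _ mu2 _ _ _ (inv_primitive c K) (inv_bound c K) T32).
- by move=> t /andP[t0 _]; exact: (inv_primitive_derive c0 _ t0).1.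
- by move=> t /andP[t0 _]; exact: (inv_primitive_derive c0 _ t0).2.
- by move=> t /andP[t0 _]; exact: stable_cos_le.
- exact: (inv_primitive_le c0 K0 (lexx 0) (ltW T32)).
Qed.

Variables (c alpha beta N : R) (phi : probability R R).
Hypothesis c0 : 0 < c.
Hypothesis a0 : 0 < alpha.
Hypothesis N1 : 1 <= N.
Hypothesis stable2 : stable_law c alpha beta mu2.
Hypothesis stable_phi : stable_law (c / N `^ alpha^-1) alpha beta phi.
Hypothesis Poisson1 : compound_Poisson N phi mu1.

Let N0 : 0 < N. Proof. exact: lt_le_trans N1. Qed.

Let T := N `^ alpha^-1 / c.

Let T0 : 0 < T. Proof. by rewrite divr_gt0// powR_gt0. Qed.

Let TcE : 256 * stable_const alpha / (T * c) = 256 * stable_const alpha * N `^ (- alpha^-1).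
Proof. by rewrite /T divfK ?gt_eqF// powRN. Qed.

Let powR_le_N t : 0 < t <= T -> (c * t) `^ alpha <= N.
Proof.
move=> /andP[t0 tT]; have ct : c * t <= N `^ alpha^-1.
  by rewrite mulrC -ler_pdivlMr.
have -> : N = (N `^ alpha^-1) `^ alpha.
  by rewrite -powRrM mulVf ?gt_eqF// powRr1 ?(ltW N0).
by apply: ge0_ler_powR; rewrite ?nnegrE ?(ltW a0) ?powR_ge0 ?mulr_ge0 ?(ltW c0) ?(ltW t0).
Qed.

(** A bound on the skewness term uniform in [t] lets [exp_bound] be the majorant. The constant [64]
    is [4 * 4 * 4]: from [M], from [exp_primitive_le] and from Esseen's inequality. *)
Lemma dKol_strict_stable (tau : R) :
  (forall t, 0 < t -> (beta * stable_h alpha t) ^+ 2 <= tau ^+ 2) ->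
  (dKol X1 X2 <= (256 * stable_const alpha * N `^ (- alpha^-1) +
                  64 * (1 + tau ^+ 2) / alpha / N)%:E)%E.
Proof.
move=> wtau; pose M := 4 * (1 + tau ^+ 2) / alpha / N.
have M0 : 0 <= M by rewrite !divr_ge0 ?(ltW a0) ?(ltW N0)// mulr_ge0// addr_ge0// sqr_ge0.
have -> : 64 * (1 + tau ^+ 2) / alpha / N = 4 * (4 * M).
  by rewrite /M; field; rewrite !gt_eqF.
rewrite -TcE; apply: (@dKol_stable_le c alpha beta T (4 * M)
  (exp_primitive c alpha M) (exp_bound c alpha M) c0 a0 T0 stable2).
- by move=> t /andP[t0 _]; exact: (exp_primitive_derive _ c0 _ t0).1.
- by move=> t /andP[t0 _]; exact: (exp_primitive_derive _ c0 _ t0).2.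
- move=> s t tT; have /andP[t0 _] := tT.
  have := stable_compound_sinB s c0 a0 N0 t0 (powR_le_N tT) stable2 stable_phi Poisson1.
  move=> /(ler_wpM2l (ler0n R 2))/le_trans; apply.
  have -> : t * exp_bound c alpha M t = 2 * (2 * (c * t) `^ alpha ^+ 2 *
      (1 + tau ^+ 2) / N * expR (- (c * t) `^ alpha / 2)).
    by rewrite /exp_bound /M; field; rewrite !gt_eqF.
  rewrite ler_pM2l// ler_pM2r ?expR_gt0// ler_pM2r ?invr_gt0//.
  apply: ler_wpM2l; first by rewrite mulr_ge0 ?sqr_ge0.
  by rewrite lerD2l wtau.
- by move=> e _; exact: exp_primitive_le.
Qed.

(** As [|beta| <= 1] and [2 / pi <= 1], the skewness term is at most [|ln t|], and
    [ln t = ln u - ln c] with [u = c t] isolates the scale. In [u^2 (1 + (ln t)^2) expR (- u / 2)]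
    one factor [u] cancels the [1 / t] of Esseen's integral; [ln_sqr_le] and [expR_half_le] reduce
    the rest to a multiple of [(1 + u)^-2]. *)
Lemma dKol_stable1 : alpha = 1 -> -1 <= beta <= 1 ->
  (dKol X1 X2 <= (log_const R * (1 + ln c ^+ 2) / N)%:E)%E.
Proof.
rewrite /log_const => a1 beta1; pose K := 36 * 768 * (c * ((1 + ln c ^+ 2) / N)).
have l0 : 0 <= 1 + ln c ^+ 2 by rewrite addr_ge0 ?sqr_ge0.
have lN : 0 <= c * ((1 + ln c ^+ 2) / N).
  by rewrite mulr_ge0 ?(ltW c0)// divr_ge0// ltW.
have K0 : 0 <= K := mulr_ge0 (mulr_ge0 (ler0n R 36) (ler0n R 768)) lN.
have S0 : 0 <= stable_const alpha by rewrite /stable_const mulr_ge0.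
apply: (@le_trans _ _ (256 * stable_const alpha / (T * c) + 4 * (K / c))%:E); last first.
  rewrite lee_fin TcE a1 invr1 powR_inv1 ?(ltW N0)//.
  have -> : 4 * (K / c) = 144 * 768 * (1 + ln c ^+ 2) / N.
    by rewrite /K; field; rewrite !gt_eqF.
  rewrite -mulrDl ler_pM2r ?invr_gt0// [leRHS]mulrDl lerD2r ler_peMr//.
    by apply: mulr_ge0 => //; rewrite -a1.
  by rewrite lerDl sqr_ge0.
apply: (@dKol_stable_le c alpha beta T (K / c)
  (inv_primitive c K) (inv_bound c K) c0 a0 T0 stable2).
- by move=> t /andP[/ltW t0 _]; exact: (inv_primitive_derive c0 _ t0).1.
- by move=> t /andP[/ltW t0 _]; exact: (inv_primitive_derive c0 _ t0).2.
- move=> s t tT; have /andP[t0 _] := tT.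
  have := stable_compound_sinB s c0 a0 N0 t0 (powR_le_N tT) stable2 stable_phi Poisson1.
  have u0 : 0 < c * t by rewrite mulr_gt0.
  have -> : (c * t) `^ alpha = c * t by rewrite a1 powRr1// ltW.
  move=> /(ler_wpM2l (ler0n R 2))/le_trans; apply.
  have wln : (beta * stable_h alpha t) ^+ 2 <= ln t ^+ 2.
    rewrite /stable_h a1 eqxx (gtr0_norm t0) mulrA exprMn.
    rewrite ler_piMl ?sqr_ge0//.
    have b2 : beta ^+ 2 <= 1.
      by have /andP[? ?] := beta1; rewrite -(real_normK (num_real beta)) exprn_ile1 ?ler_norml.
    have p1 : (2 / pi) ^+ 2 <= (1 : R).
      by rewrite exprn_ile1 ?divr_ge0 ?pi_ge0// ler_pdivrMr ?pi_gt0// mul1r pi_ge2.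
    by rewrite exprMn sqrrN mulr_ile1 ?sqr_ge0.
  have lnt : ln t ^+ 2 <= 2 * ln (c * t) ^+ 2 + 2 * ln c ^+ 2.
    have -> : ln t = ln (c * t) - ln c by rewrite lnM ?posrE// addrC addKr.
    have := sqr_ge0 (ln (c * t) + ln c); move: (ln (c * t)) (ln c) => x y *; nra.
  set u := c * t in u0 lnt *.
  have ulnu := ln_sqr_le u0; have eu := expR_half_le (ltW u0).
  (* The [9] is [8 + 1]: [ln_sqr_le] bounds [2 u (ln u)^2] by [8 (1 + u)^2], and [u] itself is at
     most [(1 + u)^2]. *)
  have H : u * (1 + (beta * stable_h alpha t) ^+ 2) <= 9 * (1 + ln c ^+ 2) * (1 + u) ^+ 2.
    apply: (@le_trans _ _ (u * (1 + (2 * ln u ^+ 2 + 2 * ln c ^+ 2)))).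
      by rewrite ler_pM2l// lerD2l (le_trans wln).
    have y0 := sqr_ge0 (ln c); move: (ln c ^+ 2) y0 => y y0.
    have uy : 0 <= u * y by rewrite mulr_ge0// ltW.
    have u2y : 0 <= u ^+ 2 * y by rewrite mulr_ge0// sqr_ge0.
    have := sqr_ge0 u; nra.
  have -> : t * inv_bound c K t = 4 * u / N * (9 * (1 + ln c ^+ 2) * (768 / (1 + u) ^+ 2)).
    rewrite /inv_bound /K -/u /u; field.
    by rewrite !gt_eqF// ltr_pwDl// ltW.
  have -> : 2 * (2 * u ^+ 2 * (1 + (beta * stable_h alpha t) ^+ 2) / N * expR (- u / 2)) =
      4 * u / N * (u * (1 + (beta * stable_h alpha t) ^+ 2) * expR (- u / 2)) by ring.
  rewrite ler_wpM2l//; first by rewrite divr_ge0 ?(ltW N0)// mulr_ge0// ltW.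
  apply: (@le_trans _ _ (9 * (1 + ln c ^+ 2) * (1 + u) ^+ 2 * expR (- u / 2))).
    by rewrite ler_pM2r ?expR_gt0.
  by rewrite -[leLHS]mulrA ler_wpM2l// mulr_ge0.
- by move=> e /andP[e0 _]; apply: inv_primitive_le => //; exact: ltW.
Qed.

End dKol.

(** For [alpha = 1], [beta <> 0] the estimate carries the factor [1 + (ln c)^2], and [(ln n)^2 / n]
    vanishes at [n = 1]. The logarithmic bound therefore takes two forms: with the universal
    constant [C'] once [n] is large in terms of [c], and from [n = 2] on with a constant depending
    on [c]. *)
Theorem proposition23 (R : realType) :
  exists (C : R -> R) (C' : R) (n0 : R -> nat) (K : R -> R),
  forall (c alpha beta : R), 0 < c -> 0 < alpha <= 2 -> -1 <= beta <= 1 ->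
  forall (d : measure_display) (T : measurableType d) (P : probability T R)
    (Y : {RV P >-> R}),
  stable_law c alpha beta (distribution P Y) ->
  forall (n : nat), (1 <= n)%N ->
  forall (phi_n : probability R R),
  stable_law (c / (n%:R `^ alpha^-1)) alpha beta phi_n ->
  forall (d' : measure_display) (T' : measurableType d')
    (P' : probability T' R) (Yn : {RV P' >-> R}),
  compound_Poisson n%:R phi_n (distribution P' Yn) ->
  [/\ (1 < alpha -> (dKol Yn Y <= (C alpha * n%:R `^ (- alpha^-1))%:E)%E),
      (alpha < 1 \/ (alpha = 1 /\ beta = 0) ->
         (dKol Yn Y <= (C alpha * n%:R^-1)%:E)%E),
      (alpha = 1 /\ beta <> 0 -> (n0 c <= n)%N ->
         (dKol Yn Y <= (C' * (ln n%:R ^+ 2 / n%:R))%:E)%E) &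
      (alpha = 1 /\ beta <> 0 -> (2 <= n)%N ->
         (dKol Yn Y <= (K c * (ln n%:R ^+ 2 / n%:R))%:E)%E)].
Proof.
pose C1 : R -> R := fun alpha => 256 * stable_const alpha.
(* The tangent has its pole at [alpha = 1]; that exponent reaches [strict] only with [beta = 0],
   where the skewness term is zero and any square bounds it. *)
pose C2 : R -> R := fun alpha => 64 * (1 + tan (pi * alpha / 2) ^+ 2) / alpha.
exists (fun alpha => C1 alpha + C2 alpha), (log_const R).
(* Beyond this threshold [ln n >= 1 + |ln c|], so [(ln n)^2] absorbs [1 + (ln c)^2]. *)
exists (fun c => Num.bound (expR (1 + `|ln c|))).
(* For [n >= 2] the quotient [(ln n)^2 / (ln 2)^2] is at least [1]. *)
exists (fun c => log_const R * (1 + ln c ^+ 2) / ln 2 ^+ 2).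
move=> c alpha beta c0 /andP[a0 a2] beta1 d T P Y stab n n1 phi phistab d' T' P' Yn nuP.
have N1 : 1 <= n%:R :> R by rewrite ler1n.
have N0 : 0 < n%:R :> R by exact: lt_le_trans N1.
have C10 : 0 <= C1 alpha by rewrite /C1 mulr_ge0// /stable_const mulr_ge0.
have C20 : 0 <= C2 alpha.
  by rewrite /C2 divr_ge0 ?(ltW a0)// mulr_ge0// addr_ge0// sqr_ge0.
have strict : alpha != 1 \/ beta = 0 ->
    (dKol Yn Y <= (C1 alpha * n%:R `^ (- alpha^-1) + C2 alpha * n%:R^-1)%:E)%E.
  move=> ab; apply: (dKol_strict_stable c0 a0 N1 stab phistab nuP) => t t0.
  have [->|b0] := eqVneq beta 0; first by rewrite mul0r expr0n sqr_ge0.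
  case: ab => [a1|b1]; last by rewrite b1 eqxx in b0.
  rewrite /stable_h (negbTE a1) exprMn ler_piMl ?sqr_ge0//.
  by rewrite -(real_normK (num_real beta)) exprn_ile1 ?ler_norml.
have ln_case : alpha = 1 ->
    (dKol Yn Y <= (log_const R * (1 + ln c ^+ 2) / n%:R)%:E)%E.
  by move=> a1; exact: (dKol_stable1 c0 a0 N1 stab phistab nuP a1 beta1).
have le_ln (u : R) : 1 + ln c ^+ 2 <= u * ln n%:R ^+ 2 -> alpha = 1 ->
    (dKol Yn Y <= (log_const R * u * (ln n%:R ^+ 2 / n%:R))%:E)%E.
  move=> H /ln_case/le_trans; apply; rewrite lee_fin mulrA ler_pM2r ?invr_gt0//.
  by rewrite -mulrA ler_wpM2l// log_const_ge0.
split.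
(* Since [1 / alpha < 1], the smoothing term [n^(- 1 / alpha)] dominates [1 / n]; in the next case
   the order is reversed. *)
- move=> a1; apply: le_trans (strict _) _; first by left; rewrite gt_eqF.
  rewrite lee_fin mulrDl lerD2l ler_wpM2l//.
  by rewrite -powR_inv1 ?(ltW N0)// ler_powR// lerN2 invf_le1// (ltW a1).
- move=> ab; apply: le_trans (strict _) _.
    by case: ab => [a1|[_ b0]]; [left; rewrite lt_eqF|right].
  rewrite lee_fin mulrDl lerD2r ler_wpM2l//.
  rewrite -[leRHS]powR_inv1 ?(ltW N0)// ler_powR// lerN2 invf_ge1//.
  by case: ab => [/ltW|[->]].
- move=> [a1 _] n0n; rewrite -[log_const R]mulr1; apply: le_ln => //.
  rewrite mul1r.
  have : expR (1 + `|ln c|) <= n%:R.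
    by rewrite (le_trans (ltW (archi_boundP (expR_ge0 _))))// ler_nat.
  rewrite -ler_ln ?posrE ?expR_gt0// expRK => lnn.
  have := normr_ge0 (ln c); have := real_normK (num_real (ln c)).
  move: (`|ln c|) lnn => l lnn <- l0; have : (1 + l) ^+ 2 <= ln n%:R ^+ 2.
    by rewrite ler_sqr ?nnegrE ?(le_trans _ lnn)// addr_ge0.
  by apply: le_trans; nra.
- move=> [a1 _] n2; have ln20 : 0 < ln 2 ^+ 2 :> R.
    by rewrite exprn_gt0// ln_gt0// ltr1n.
  rewrite -[X in X * (_ / _)]mulrA; apply: le_ln => //.
  rewrite -mulrA ler_peMr ?addr_ge0 ?sqr_ge0//.
  rewrite mulrC ler_pdivlMr// mul1r ler_sqr ?nnegrE ?ln_ge0 ?ler1n//.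
  by rewrite ler_ln ?posrE// ler_nat.
Qed.
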